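(* Let $G \curvearrowright X$ and $H \curvearrowright Y$ be topologically free topological dynamical systems, and assume that $X$ and $Y$ are second countable. The following are equivalent: (i) $G \curvearrowright X$ and $H \curvearrowright Y$ are continuously orbit equivalent; (ii) the transformation groupoids $G \ltimes X$ and $H \ltimes Y$ are isomorphic as topological groupoids; (iii) there is a $C^*$-isomorphism $\Phi: C_0(X) \rtimes_r G \to C_0(Y) \rtimes_r H$ of reduced crossed products with $\Phi(C_0(X)) = C_0(Y)$.
   Context: All groups are discrete and countable; all topological spaces are locally compact and Hausdorff. A topological dynamical system $G \curvearrowright X$ is an action $(g,x) \mapsto g.x$ of a group $G$ on a space $X$ by homeomorphisms. It is topologically free if for every $e \neq g \in G$ the set $\{x \in X : g.x \neq x\}$ is dense in $X$. $G \curvearrowright X$ and $H \curvearrowright Y$ are continuously orbit equivalent if there exist a homeomorphism $\varphi: X \to Y$ with inverse $\psi = \varphi^{-1}$ and continuous maps $a: G \times X \to H$, $b: H \times Y \to G$ (with $G$, $H$ discrete) such that $\varphi(g.x) = a(g,x).\varphi(x)$ and $\psi(h.y) = b(h,y).\psi(y)$ for all $g \in G$, $x \in X$, $h \in H$, $y \in Y$. The transformation groupoid $G \ltimes X$ is the space $G \times X$ with multiplication $(g',x')(g,x) = (g'g,x)$ if $x' = g.x$, inversion $(g,x)^{-1} = (g^{-1},g.x)$, range map $r(g,x) = g.x$ and source map $s(g,x) = x$. The algebra $C_0(X)$ is viewed as a subalgebra of $C_0(X) \rtimes_r G$ via the canonical embedding. *)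

(* Defs.v *)
From HB Require Import structures.
From mathcomp Require Import all_boot all_order all_algebra.
From mathcomp Require Import all_classical all_reals all_analysis.
From mathcomp Require Import complex.
From mathcomp Require Import summability.
From mathcomp Require Import ring lra.

Set Implicit Arguments.
Unset Strict Implicit.
Unset Printing Implicit Defensive.

Import Order.TTheory GRing.Theory Num.Theory numFieldNormedType.Exports.

Local Open Scope classical_set_scope.
Local Open Scope ring_scope.

(* The complex numbers [R[i]] with the topology of their modulus. *)
HB.instance Definition _ (R : realType) := NormedModule.copy R[i] R[i]^o.

Local Notation normc := Normc.normc.

(** * Dynamical systems *)

(* Each [act g] is a homeomorphism, with inverse [act g^-1]. *)
Record dynSys (G : groupType) (X : topologicalType) := DynSys {
  act :> G -> X -> X;
  act1 : forall x, act 1%g x = x;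
  actM : forall g h x, act (g * h)%g x = act g (act h x);
  act_continuous : forall g, continuous (act g)
}.

Definition topologically_free (G : groupType) (X : topologicalType)
    (aG : dynSys G X) :=
  forall g : G, g <> 1%g -> dense [set x | aG g x <> x].

Definition inverse_homeos (X Y : topologicalType) (f : X -> Y) (g : Y -> X) :=
  [/\ cancel f g, cancel g f, continuous f & continuous g].

Definition continuously_orbit_equivalent (G H : groupType)
    (X Y : topologicalType) (aG : dynSys G X) (aH : dynSys H Y) :=
  exists (phi : X -> Y) (psi : Y -> X)
         (a : discrete_topology G * X -> discrete_topology H)
         (b : discrete_topology H * Y -> discrete_topology G),
  [/\ inverse_homeos phi psi,
      continuous a, continuous b,
      forall g x, phi (aG g x) = aH (a (g, x)) (phi x) &
      forall h y, psi (aH h y) = aG (b (h, y)) (psi y)].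

(** * Topological groupoids *)

(* [gmul c d], the product of [c] after [d], is only meaningful on the
   composable pairs, those with [gsrc c = grng d]. *)
Record topGroupoid := TopGroupoid {
  garr : topologicalType;
  gobj : topologicalType;
  gsrc : garr -> gobj;
  grng : garr -> gobj;
  gunit : gobj -> garr;
  gmul : garr -> garr -> garr;
  ginv : garr -> garr;
  gsrc_unit : forall x, gsrc (gunit x) = x;
  grng_unit : forall x, grng (gunit x) = x;
  gsrc_mul : forall c d, gsrc c = grng d -> gsrc (gmul c d) = gsrc d;
  grng_mul : forall c d, gsrc c = grng d -> grng (gmul c d) = grng c;
  gmulA : forall b c d, gsrc b = grng c -> gsrc c = grng d ->
    gmul b (gmul c d) = gmul (gmul b c) d;
  gmul1l : forall c, gmul (gunit (grng c)) c = c;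
  gmul1r : forall c, gmul c (gunit (gsrc c)) = c;
  gsrc_inv : forall c, gsrc (ginv c) = grng c;
  grng_inv : forall c, grng (ginv c) = gsrc c;
  gmulVl : forall c, gmul (ginv c) c = gunit (gsrc c);
  gmulVr : forall c, gmul c (ginv c) = gunit (grng c);
  gsrc_continuous : continuous gsrc;
  grng_continuous : continuous grng;
  gunit_continuous : continuous gunit;
  ginv_continuous : continuous ginv;
  gmul_continuous : {within [set p : garr * garr | gsrc p.1 = grng p.2],
    continuous (fun p : garr * garr => gmul p.1 p.2)}
}.

(* Homeomorphisms of the arrows and of the unit spaces which together form
   a functor; the inverse maps then form the inverse functor, and inverses
   of arrows are preserved. *)
Definition topGroupoid_isomorphic (A B : topGroupoid) :=
  exists (F : garr A -> garr B) (F' : garr B -> garr A)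
         (f : gobj A -> gobj B) (f' : gobj B -> gobj A),
  [/\ inverse_homeos F F', inverse_homeos f f',
      (forall c, gsrc (F c) = f (gsrc c)) /\
        (forall c, grng (F c) = f (grng c)),
      forall x, F (gunit x) = gunit (f x) &
      forall c d, gsrc c = grng d -> F (gmul c d) = gmul (F c) (F d)].

Section transformation_groupoid.
Variables (G : groupType) (X : topologicalType) (aG : dynSys G X).

Local Notation arrow := (discrete_topology G * X)%type.

Definition tg_src (c : arrow) : X := c.2.
Definition tg_rng (c : arrow) : X := aG c.1 c.2.
Definition tg_unit (x : X) : arrow := (1%g : G, x).
Definition tg_mul (c d : arrow) : arrow := (((c.1 : G) * d.1)%g, d.2).
Definition tg_inv (c : arrow) : arrow := (((c.1 : G)^-1)%g, aG c.1 c.2).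

Lemma tg_near (p : arrow) (P : set arrow) :
  (\forall x \near p.2, P (p.1, x)) -> nbhs p P.
Proof.
move=> nP; exists ([set p.1], [set x | P (p.1, x)]) => /=.
  by split=> //; exact: discrete_set1.
by move=> [g x] /= [-> ].
Qed.

Lemma tg_continuous (T : topologicalType) (f : arrow -> T) :
  (forall g, continuous (fun x => f (g, x))) -> continuous f.
Proof.
move=> cf [g x] A /= nA.
by apply: tg_near => /=; exact: (cf g x A nA).
Qed.

Lemma tg_src_continuous : continuous tg_src.
Proof. by apply: tg_continuous => g x; exact: cvg_id. Qed.

Lemma tg_rng_continuous : continuous tg_rng.
Proof. by apply: tg_continuous => g; exact: act_continuous. Qed.

Lemma tg_unit_continuous : continuous tg_unit.
Proof.
by move=> x; exact: (cvg_pair (cvg_cst (1%g : discrete_topology G)) cvg_id).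
Qed.

Lemma tg_inv_continuous : continuous tg_inv.
Proof.
apply: tg_continuous => g x.
exact: (cvg_pair (cvg_cst (g^-1%g : discrete_topology G))
                 (@act_continuous _ _ aG g x)).
Qed.

Lemma tg_mul_continuous : continuous (fun p : arrow * arrow => tg_mul p.1 p.2).
Proof.
move=> [[g x] [h y]].
set q : arrow * arrow := ((g, x), (h, y)).
have c1 : (fun p : arrow * arrow =>
    (((p.1.1 : G) * p.2.1)%g : discrete_topology G)) @ nbhs q -->
    ((g * h)%g : discrete_topology G).
  apply/discrete_cvg.
  exists ([set c | c.1 = g], [set c | c.1 = h]).
    by split; apply: tg_near; exact: nearW.
  by move=> [c d] /= [-> ->].
have c2 : (fun p : arrow * arrow => p.2.2) @ nbhs q --> y.
  move=> A nA; exists (setT, [set c | A c.2]) => /=; last first.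
    by move=> [c d] /= [_ ].
  by split; [exact: filterT|exact: tg_near].
exact: (cvg_pair c1 c2).
Qed.

Lemma tg_gmulA (b c d : arrow) : tg_mul b (tg_mul c d) = tg_mul (tg_mul b c) d.
Proof. by rewrite /tg_mul /= mulgA. Qed.

Definition transformation_groupoid : topGroupoid.
Proof.
refine (@TopGroupoid arrow X tg_src tg_rng tg_unit tg_mul tg_inv
  _ _ _ _ _ _ _ _ _ _ _ tg_src_continuous tg_rng_continuous
  tg_unit_continuous tg_inv_continuous
  (continuous_subspaceT tg_mul_continuous)).
- by [].
- by move=> x; exact: act1.
- by [].
- by move=> c d scd; rewrite /tg_rng /= actM; congr (aG _ _); exact/esym.
- by move=> b c d _ _; exact: tg_gmulA.
- by move=> [g x]; rewrite /tg_mul /= mul1g.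
- by move=> [g x]; rewrite /tg_mul /= mulg1.
- by [].
- by move=> [g x]; rewrite /tg_rng /= -actM mulVg act1.
- by move=> [g x]; rewrite /tg_mul /= mulVg.
- by move=> [g x]; rewrite /tg_mul /= mulgV.
Defined.

End transformation_groupoid.

(** * Operators on the Hilbert space l2(I) *)

Section l2.
Variables (R : realType) (I : choiceType).
Local Notation C := R[i].
Implicit Types (xi eta : I -> C).

Definition sqsum xi : \bar R :=
  \esum_(i in [set: I]) ((normc (xi i) ^+ 2)%:E).

Definition l2_pred : {pred I -> C} := mem [set xi | (sqsum xi < +oo)%E].

Lemma sqsum_ge0 xi : (0 <= sqsum xi)%E.
Proof. by apply: esum_ge0 => i _; rewrite lee_fin sqr_ge0. Qed.

Lemma l2_predP xi : reflect (sqsum xi < +oo)%E (xi \in l2_pred).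
Proof. by apply: (iffP idP); rewrite !inE. Qed.

Lemma le_esumZ (c : R) (a b : I -> R) : 0 <= c -> (forall i, 0 <= a i) ->
  (forall i, 0 <= b i <= c * a i) ->
  (\esum_(i in [set: I]) (b i)%:E <=
     c%:E * \esum_(i in [set: I]) (a i)%:E)%E.
Proof.
move=> c0 a0 bca; apply: ge_ereal_sup => _ [A [finA _] <-].
apply: (@le_trans _ _ (\sum_(i \in A) (c%:E * (a i)%:E))%E).
  apply: lee_fsum => // i _; rewrite -EFinM lee_fin.
  by have /andP[] := bca i.
rewrite -ge0_mule_fsumr; last by move=> i; rewrite lee_fin.
apply: lee_wpmul2l; first by rewrite lee_fin.
by apply: ereal_sup_ubound; exists A.
Qed.

Lemma l2_pred_dom xi eta (c : R) : 0 <= c ->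
  (forall i, normc (eta i) <= c * normc (xi i)) ->
  xi \in l2_pred -> eta \in l2_pred.
Proof.
move=> c0 le_eta /l2_predP fin_xi; apply/l2_predP.
have normc_ge0 (z : C) : 0 <= normc z.
  by case: z => x y; exact: sqrtr_ge0.
apply: (@le_lt_trans _ _ ((c ^+ 2)%:E * sqsum xi)%E).
  apply: le_esumZ; [exact: sqr_ge0|by move=> i; exact: sqr_ge0|move=> i].
  by rewrite sqr_ge0/= -exprMn ler_pXn2r // nnegrE // mulr_ge0.
by apply: lte_mul_pinfty => //; rewrite lee_fin sqr_ge0.
Qed.

Lemma l2_submod_closed : submod_closed l2_pred.
Proof.
have normc_ge0 (z : C) : 0 <= normc z.
  by case: z => x y; exact: sqrtr_ge0.
split.
  apply/l2_predP; rewrite /sqsum esum1 // => i _.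
  by rewrite Normc.normc0 expr0n.
move=> c xi eta xil etal; apply/l2_predP.
have /l2_predP cxil : c *: xi \in l2_pred.
  apply: (@l2_pred_dom xi _ (normc c)) => // i.
  by rewrite /= Normc.normcM.
move: (c *: xi) cxil => {xil}xi xil; move/l2_predP: etal => etal.
apply: (@le_lt_trans _ _ (2%:E * (\esum_(i in [set: I])
    (normc (xi i) ^+ 2 + normc (eta i) ^+ 2)%:E))%E).
  apply: le_esumZ => // i; first by rewrite addr_ge0 ?sqr_ge0.
  rewrite sqr_ge0 /=.
  have := le_normcD (xi i) (eta i).
  have := normc_ge0 (xi i); have := normc_ge0 (eta i).
  have := normc_ge0 (xi i + eta i).
  move: (normc (xi i + eta i)) (normc (xi i)) (normc (eta i)) => s x y.
  move=> s0 y0 x0 sxy; have : s ^+ 2 <= (x + y) ^+ 2.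
    by rewrite ler_pXn2r // nnegrE addr_ge0.
  by have := sqr_ge0 (x - y); nra.
apply: lte_mul_pinfty => //.
under eq_esum do rewrite EFinD.
by rewrite esumD ?lte_add_pinfty // => i _; rewrite lee_fin sqr_ge0.
Qed.

HB.instance Definition _ :=
  GRing.isSubmodClosed.Build C (I -> C) l2_pred l2_submod_closed.

Record l2 := L2 { l2fun :> I -> C; l2funP : l2fun \in l2_pred }.

HB.instance Definition _ := [isSub for l2fun].
HB.instance Definition _ := [Choice of l2 by <:].
HB.instance Definition _ := [SubChoice_isSubLmodule of l2 by <:].

(* [sum] is the limit of the net of finite partial sums. *)
Definition l2inner (xi eta : l2) : C :=
  summability.sum (fun i => xi i * (eta i)^* : C).

Definition l2norm (xi : l2) : R := Num.sqrt (fine (sqsum xi)).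

Definition opnorm_le (T : l2 -> l2) (M : R) :=
  forall xi : l2, l2norm (T xi) <= M * l2norm xi.

Definition bounded_op (T : l2 -> l2) := linear T /\ exists M, opnorm_le T M.

Definition is_adjoint (S T : l2 -> l2) :=
  forall xi eta : l2, l2inner (T xi) eta = l2inner xi (S eta).

Definition norm_closure (A : set (l2 -> l2)) : set (l2 -> l2) :=
  [set T | bounded_op T /\
    forall e : R, 0 < e -> exists2 S, A S & opnorm_le (T - S) e].

End l2.

(* Isomorphisms of concrete C*-algebras [A] of operators on l2(I) and [B] of
   operators on l2(J): bijective *-homomorphisms.  Only the values of [Phi] on
   [A] matter; since [A] contains the (unique) adjoints of its elements, the
   last clause reads Phi(T^* ) = Phi(T)^*. *)
Definition cstar_isomorphism (R : realType) (I J : choiceType)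
    (A : set (l2 R I -> l2 R I)) (B : set (l2 R J -> l2 R J))
    (Phi : (l2 R I -> l2 R I) -> (l2 R J -> l2 R J)) :=
  [/\ set_bij A B Phi,
      forall S T, A S -> A T -> Phi (S + T) = Phi S + Phi T,
      forall (c : R[i]) T, A T -> Phi (c *: T) = c *: Phi T,
      forall S T, A S -> A T -> Phi (S \o T) = Phi S \o Phi T &
      forall S T, A S -> A T -> is_adjoint S T ->
        is_adjoint (Phi S) (Phi T)].

(** * Reduced crossed products *)

Record C0 (R : realType) (X : topologicalType) := MkC0 {
  c0fun :> X -> R[i];
  c0_continuous : continuous c0fun;
  c0_vanish : forall e : R, 0 < e -> compact [set x | e <= normc (c0fun x)]
}.

Section c0_bounded.
Variables (R : realType) (X : topologicalType).

Lemma normc_continuous : continuous (@normc R).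
Proof.
move=> z; apply/(@cvgrPdist_lt _ _ _ (nbhs z) (nbhs_filter z)) => e e0.
have nz : nbhs z (ball z (e%:C)%C) by apply: nbhsx_ballx; rewrite ltcR.
apply: filterS nz => w; rewrite -ball_normE /= => zw.
have {}zw : normc (z - w) < e by rewrite -ltcR.
rewrite ltr_norml; apply/andP; split.
  have := le_normcD (w - z) z; rewrite subrK.
  have -> : normc (w - z) = normc (z - w) by rewrite -opprB normcN.
  by lra.
by have := le_normcD (z - w) w; rewrite subrK; lra.
Qed.

Lemma c0_bounded (f : C0 R X) :
  exists2 M : R, 0 <= M & forall x, normc (f x) <= M.
Proof.
have cK := c0_vanish (c := f) ltr01.
have : compact ((fun x => normc (f x)) @` [set x | 1 <= normc (f x)]).
  apply: continuous_compact cK; apply: continuous_subspaceT => x.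
  by apply: continuous_comp; [exact: c0_continuous|exact: normc_continuous].
move=> /compact_bounded[M [_ boundM]].
exists (1 + `|M|); first by rewrite addr_ge0.
move=> x; case: (lerP 1 (normc (f x))) => fx; last first.
  by rewrite (le_trans (ltW fx)) // lerDl.
have MM : M < 1 + `|M| by rewrite (le_lt_trans (ler_norm M)) // ltrDr.
apply: (le_trans (ler_norm _)); apply: (boundM _ MM).
by exists x.
Qed.

End c0_bounded.

(* The reduced crossed product is the norm closure of the image of
   C_c(G, C_0(X)) in the regular representation induced by a faithful
   representation of C_0(X), and does not depend on the latter up to canonical
   isomorphism.  Here C_0(X) acts on l2(X) by multiplication; the induced
   regular representation on l2(G, l2(X)) = l2(G x X) is
     (pi(f) xi)(g, x) = (g^-1.f)(x) xi(g, x) = f(g.x) xi(g, x),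
     (lambda(h) xi)(g, x) = xi(h^-1 g, x),
   which satisfies lambda(h) pi(f) lambda(h)^* = pi(h.f), where
   (h.f)(x) = f(h^-1.x). *)
Section crossed_product.
Variables (R : realType) (G : groupType) (X : topologicalType).
Variable aG : dynSys G X.

Local Notation Hilb := (l2 R (G * X)%type).

Lemma regular_pi_subproof (f : C0 R X) (xi : Hilb) :
  (fun p : G * X => f (aG p.1 p.2) * xi p) \in @l2_pred R (G * X)%type.
Proof.
have [M M0 fM] := c0_bounded f.
apply: (l2_pred_dom M0 _ (l2funP xi)) => p; rewrite Normc.normcM.
by apply: ler_wpM2r => //; case: (xi p) => x y; exact: sqrtr_ge0.
Qed.

Definition regular_pi (f : C0 R X) (xi : Hilb) : Hilb :=
  L2 (regular_pi_subproof f xi).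

Lemma regular_lambda_subproof (h : G) (xi : Hilb) :
  (fun p : G * X => xi ((h^-1 * p.1)%g, p.2)) \in @l2_pred R (G * X)%type.
Proof.
apply/l2_predP; have /l2_predP := l2funP xi; rewrite /sqsum.
rewrite (@reindex_esum R _ _ setT setT
  (fun p : G * X => ((h^-1 * p.1)%g, p.2))) //.
split=> //.
- by move=> [g x] [k y] _ _ /= [/mulgI -> ->].
- by move=> [g x] _; exists ((h * g)%g, x) => //=; rewrite mulKg.
Qed.

Definition regular_lambda (h : G) (xi : Hilb) : Hilb :=
  L2 (regular_lambda_subproof h xi).

(* The image of C_c(G, C_0(X)). *)
Definition algebraic_crossed_product : set (Hilb -> Hilb) :=
  [set T | exists s : seq (C0 R X * G),
    T = \sum_(p <- s) (regular_pi p.1 \o regular_lambda p.2)].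

Definition reduced_crossed_product : set (Hilb -> Hilb) :=
  norm_closure algebraic_crossed_product.

(* The canonical copy of C_0(X), f |-> pi(f) lambda(1). *)
Definition C0_in_crossed_product : set (Hilb -> Hilb) := range regular_pi.

End crossed_product.

Arguments reduced_crossed_product R {G X} aG.
Arguments C0_in_crossed_product R {G X} aG.

(* Main.v *)
(* A continuous orbit equivalence (phi, a) and an isomorphism F of the
   transformation groupoids determine each other by F(g, x) = (a(g, x), phi(x)):
   topological freeness forces the locally constant map a to be a cocycle, since
   two group elements acting in the same way on an open set are equal.

   A groupoid isomorphism permutes the basis of l2(G x X), the arrows, and
   conjugation by this permutation carries f to f o phi^-1 and f g to the
   operator (f o phi^-1) c, where c is the locally constant H-valued function
   z |-> a(g^-1, phi^-1(z))^-1; up to a small norm error, only finitely many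
   values of c matter, and (f o phi^-1) c is a finite sum of elements f_i h_i.

   Conversely, an isomorphism Phi mapping C_0(X) onto C_0(Y) is given there by
   f |-> f o psi for a homeomorphism psi, because characters of C_0(X) are point
   evaluations.  For n = f g and b in C_0(X) one has n b = (g.b) n, so a nonzero
   matrix coefficient of Phi(n) at an arrow (h, y) forces
   psi(h y) = g psi(y).  The coefficients are continuous in y and do not all
   vanish, so psi(h z) = g psi(z) for all z near y; by freeness h is unique,
   hence locally constant in y, and an orbit equivalence cocycle. *)

Require Import Defs.
From HB Require Import structures.
From mathcomp Require Import all_boot all_order all_algebra.
From mathcomp Require Import all_classical all_reals all_analysis.
From mathcomp Require Import finmap complex summability.
From mathcomp Require Import ring lra.

Set Implicit Arguments.
Unset Strict Implicit.
Unset Printing Implicit Defensive.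

Import Order.TTheory GRing.Theory Num.Theory numFieldNormedType.Exports.

Local Open Scope classical_set_scope.
Local Open Scope ring_scope.

Local Notation normc := Normc.normc.

(** * Continuous functions vanishing at infinity *)

Section normc.
Context {R : realType}.
Implicit Types z w : R[i].

Lemma normc_ge0 z : 0 <= normc z.
Proof. by case: z => a b; exact: sqrtr_ge0. Qed.

Lemma normc_normr z : (normc z)%:C%C = `|z|.
Proof. by rewrite normc_def; case: z. Qed.

Lemma normc_real (r : R) : normc (r%:C)%C = `|r|.
Proof. by rewrite /= expr0n addr0 sqrtr_sqr. Qed.

Lemma normc1 : normc (1 : R[i]) = 1.
Proof. by rewrite (normc_real 1) normr1. Qed.

Lemma normc_conj z : normc z^* = normc z.
Proof. by case: z => a b /=; rewrite sqrrN. Qed.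

Lemma normc_gt0 z : (0 < normc z) = (z != 0).
Proof.
rewrite lt_neqAle normc_ge0 andbT eq_sym; congr (~~ _).
by apply/eqP/eqP => [/Normc.eq0_normc//|->]; exact: Normc.normc0.
Qed.

Lemma normc_cvg (T : Type) (F : set_system T) (FF : Filter F)
    (f : T -> R[i]) (z : R[i]) :
  f @ F --> z <-> forall e : R, 0 < e -> \forall t \near F, normc (z - f t) < e.
Proof.
split => [/(@cvgrPdist_lt _ _ _ F FF) fz e e0|fz].
  have := fz e%:C%C; rewrite ltcR => /(_ e0); apply: filterS => t.
  by rewrite -normc_normr ltcR.
apply/(@cvgrPdist_lt _ _ _ F FF) => e; case: e => a b.
rewrite ltcE /= => /andP[/eqP -> a0].
by apply: filterS (fz a a0) => t; rewrite -normc_normr ltcR.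
Qed.

Lemma continuous_normc (T : topologicalType) (f : T -> R[i]) :
  continuous f <->
  forall x (e : R), 0 < e -> \forall y \near x, normc (f x - f y) < e.
Proof.
by split=> cf x; [have /normc_cvg := cf x; apply|apply/normc_cvg; exact: cf].
Qed.

Lemma conjc_continuous : continuous (fun z : R[i] => z^*).
Proof.
apply/continuous_normc => z e e0.
have /continuous_normc/(_ z e e0) : continuous (@idfun R[i]) by move=> w; exact: cvg_id.
by apply: filterS => w /=; rewrite -rmorphB normc_conj.
Qed.

Lemma real_complex_continuous : continuous (fun r : R => (r%:C)%C : R[i]).
Proof.
apply/continuous_normc => r e e0.
have : \forall t \near nbhs r, `|r - t| < e by apply: cvgr_dist_lt e0; exact: cvg_id.
by apply: filterS => t; rewrite -rmorphB normc_real.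
Qed.

End normc.

(** * Local-to-global arguments on compact sets *)

Section compact_local.
Context {X : topologicalType}.

(* Otherwise the sets A with Q (K \ A) form a proper filter without a cluster
   point in K. *)
Lemma compact_local (K : set X) (Q : set X -> Prop) : compact K ->
  Q set0 -> (forall A B, A `<=` B -> Q B -> Q A) ->
  (forall A B, Q A -> Q B -> Q (A `|` B)) ->
  (forall x, K x -> exists2 U, nbhs x U & Q U) -> Q K.
Proof.
move=> cK Q0 Qs QU Qloc; apply: contrapT => nQK.
pose F : set_system X := [set A | Q (K `\` A)].
have FF : ProperFilter F.
  split; first by rewrite /F /= setD0.
  split.
  - by rewrite /F /= setDT.
  - by move=> A B FA FB; rewrite /F /= setDIr; exact: QU.
  - by move=> A B AB; apply: Qs; exact: setDS.
have [|x [Kx clx]] := cK F FF; first by rewrite /F /= setDv.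
have [U nU QU'] := Qloc x Kx.
have FU : F (~` U) by rewrite /F /= setDE setCK; apply: Qs QU' => y [].
by have [y []] := clx _ _ FU nU.
Qed.

(** A map to a discrete space is constant near each point, and lists of values concatenate under
    unions. This makes the sum in [conj_generator] finite. *)
Lemma compact_finite_values (T : choiceType) (k : X -> discrete_topology T) (K : set X) :
  compact K -> continuous k -> exists s : seq T, forall x, K x -> (k x : T) \in s.
Proof.
move=> cK ck.
apply: (@compact_local K (fun A => exists s : seq T, forall x, A x -> (k x : T) \in s)) => //.
- by exists [::].
- by move=> A B AB [s hs]; exists s => x /AB; exact: hs.
- move=> A B [s hs] [t ht]; exists (s ++ t) => x; rewrite mem_cat.
  by case=> [/hs ->|/ht ->]//; rewrite orbT.
- move=> x _; exists (k @^-1` [set k x]); first by apply: ck; exact: discrete_set1.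
  by exists [:: (k x : T)] => y /= ->; rewrite mem_seq1.
Qed.

End compact_local.

Section C0_theory.
Context {R : realType} {X : topologicalType}.
Implicit Types f g : C0 R X.

Lemma c0_ext f g : (forall x, f x = g x) -> f = g.
Proof.
case: f g => f cf vf [g cg vg] /= /funext fg.
by case: _ / fg cg vg => cg vg; congr MkC0; exact: Prop_irrelevance.
Qed.

Lemma closed_normc_ge (f : X -> R[i]) (e : R) :
  continuous f -> closed [set x | e <= normc (f x)].
Proof.
move=> cf; apply: (@closed_comp _ _ (fun x => normc (f x)) [set r | e <= r]).
  by move=> x _; apply: continuous_comp; [exact: cf|exact: normc_continuous].
exact: closed_ge.
Qed.

(** The superlevel sets of [g] are closed and contained in superlevel sets of [f], which are
    compact. *)
Lemma c0_dom (f : C0 R X) (g : X -> R[i]) (M : R) : continuous g ->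
  (forall x, normc (g x) <= M * normc (f x)) ->
  exists g0 : C0 R X, forall x, g0 x = g x.
Proof.
move=> cg gf; suff v : forall e : R, 0 < e -> compact [set x | e <= normc (g x)].
  by exists (MkC0 cg v).
(* The summand 1 makes the divisor positive whatever the sign of [M]. *)
move=> e e0; pose M' := 1 + `|M|.
have M'0 : 0 < M' by rewrite ltr_pwDl.
apply: (subclosed_compact (closed_normc_ge cg) (c0_vanish (c := f) (divr_gt0 e0 M'0))).
move=> x /= egx; rewrite ler_pdivrMr // (le_trans egx) // (le_trans (gf x)) //.
rewrite mulrC; apply: ler_wpM2l; first exact: normc_ge0.
by rewrite (le_trans (ler_norm M)) // lerDr.
Qed.

Lemma c0_add f g : exists h : C0 R X, forall x, h x = f x + g x.
Proof.
have ch : continuous (fun x => f x + g x).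
  by move=> x; apply: cvgD; exact: c0_continuous.
suff v : forall e : R, 0 < e -> compact [set x | e <= normc (f x + g x)].
  by exists (MkC0 ch v).
move=> e e0; have e2 : 0 < e / 2 by lra.
apply: (subclosed_compact (closed_normc_ge ch)
  (compactU (c0_vanish (c := f) e2) (c0_vanish (c := g) e2))).
move=> x /= efg; have := le_normcD (f x) (g x).
by case: (lerP (e / 2) (normc (f x))) => ?; [left|right; lra].
Qed.

Lemma c0_mulb f (g : X -> R[i]) (M : R) : continuous g ->
  (forall x, normc (g x) <= M) -> exists h : C0 R X, forall x, h x = f x * g x.
Proof.
move=> cg gM; apply: (@c0_dom f _ M) => [x|x].
  by apply: cvgM; [exact: c0_continuous|exact: cg].
by rewrite Normc.normcM mulrC; apply: ler_wpM2r => //; exact: normc_ge0.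
Qed.

Lemma c0_mul f g : exists h : C0 R X, forall x, h x = f x * g x.
Proof.
by have [M _ gM] := c0_bounded g; exact: c0_mulb (@c0_continuous _ _ g) gM.
Qed.

Lemma c0_comp (Y : topologicalType) (f : C0 R Y) (k : X -> Y) (k' : Y -> X) :
  inverse_homeos k k' -> exists h : C0 R X, forall x, h x = f (k x).
Proof.
move=> [kK k'K ck ck']; have ch : continuous (fun x => f (k x)).
  by move=> x; apply: continuous_comp; [exact: ck|exact: c0_continuous].
suff v : forall e : R, 0 < e -> compact [set x | e <= normc (f (k x))].
  by exists (MkC0 ch v).
move=> e e0.
have -> : [set x | e <= normc (f (k x))] = k' @` [set y | e <= normc (f y)].
  apply/seteqP; split => [x /= ex|_ [y ey <-]] /=; last by rewrite k'K.
  by exists (k x).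
apply: continuous_compact; last exact: c0_vanish.
exact: continuous_subspaceT.
Qed.

Lemma c0_indic f (T : choiceType) (k : X -> discrete_topology T) (t : T) :
  continuous k -> exists h : C0 R X, forall x, h x = (if (k x : T) == t then f x else 0).
Proof.
move=> ck.
have [||h hE] := @c0_mulb f (fun x => if (k x : T) == t then 1 else 0) 1; last first.
- by exists h => x; rewrite hE; case: ifP => _; rewrite ?mulr1 ?mulr0.
- by move=> x; case: ifP => _; rewrite ?normc1 ?Normc.normc0.
- move=> x A /nbhs_singleton Ax; rewrite /nbhs /=.
  have : nbhs x (k @^-1` [set k x]) by apply: ck; exact: discrete_set1.
  by apply: filterS => y /= ->.
Qed.

End C0_theory.

(** * Urysohn functions in C_0(X) *)

Section C0_separation.
Context {R : realType} {X : topologicalType}.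
Hypotheses (lcX : locally_compact [set: X]) (hausX : hausdorff_space X).

(** With [V] a compact neighbourhood of [x], complete regularity gives a function that is 0 at [x]
    and 1 off the interior of the intersection of [U] and [V]. One minus it is zero off [V], hence
    vanishes at infinity. *)
Lemma c0_urysohn (x : X) (U : set X) : nbhs x U ->
  exists f : C0 R X, f x = 1 /\ forall y, ~ U y -> f y = 0.
Proof.
move=> nU; have [V] := lcX I (x := x); rewrite withinET => nV [cV clV].
have [|f [cf f01 fx fB]] := (@uniform_separatorP _ R [set x] (~` (U `&` V)^°)).1 _.
  apply: (@locally_compact_completely_regular X R lcX hausX).
    by apply: open_closedC; exact: open_interior.
  by move=> /(_ (filterI nU nV)).
have f1 y : ~ (U `&` V) y -> f y = 1.
  by move=> UVy; apply: fB; exists y => // /interior_subset.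
have cg : continuous (fun y => ((1 - f y)%:C)%C : R[i]).
  move=> y; apply: (@continuous_comp _ _ _ (fun y => 1 - f y)); last exact: real_complex_continuous.
  by apply: cvgB; [exact: cvg_cst|exact: cf].
suff v : forall e : R, 0 < e -> compact [set y | e <= normc ((1 - f y)%:C)%C].
  exists (MkC0 cg v) => /=; split; first by rewrite (fx (f x)) ?subr0 //; exists x.
  by move=> y Uy; rewrite f1 ?subrr // => -[].
move=> e e0; apply: (subclosed_compact (closed_normc_ge cg) cV) => y.
rewrite /mkset normc_real => ey.
apply: contrapT => Vy; have fy : f y = 1 by apply: f1 => -[].
by move: ey; rewrite fy subrr normr0 leNgt e0.
Qed.

Lemma c0_separates (x y : X) : (forall f : C0 R X, f x = f y) -> x = y.
Proof.
move=> fxy; apply: contrapT => xy.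
have cly : closed [set y].
  by apply: accessible_closed_set1; exact: hausdorff_accessible.
have [f [fx fy]] := c0_urysohn (open_nbhs_nbhs (conj (closed_openC cly) xy)).
have /eqP := fxy f; rewrite fx fy ?oner_eq0 //.
by move/(_ erefl).
Qed.

(** Take [f] equal to 1 at [k y] and to 0 off [U]: wherever [f (k z)] is at distance less than 1
    from 1 it is nonzero, so [k z] lies in [U]. *)
Lemma continuous_c0 (Y : topologicalType) (k : Y -> X) :
  (forall f : C0 R X, continuous (fun y => f (k y))) -> continuous k.
Proof.
move=> cfk y U nU; have [f [fk fU]] := c0_urysohn nU.
have /continuous_normc/(_ y 1 ltr01) := cfk f.
rewrite /nbhs /=; apply: filterS => z; rewrite fk => fz.
by apply: contrapT => /fU fz0; move: fz; rewrite fz0 subr0 normc1 ltxx.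
Qed.

End C0_separation.

(** * Characters of C_0(X) are point evaluations *)

Section character.
Context {R : realType} {X : topologicalType}.
Implicit Types f g : C0 R X.

Lemma c0_scale (c : R[i]) f : exists h : C0 R X, forall x, h x = c * f x.
Proof.
apply: (@c0_dom _ _ f _ (normc c)) => [x|x]; last by rewrite Normc.normcM.
by apply: cvgM; [exact: cvg_cst|exact: c0_continuous].
Qed.

Lemma c0_conj f : exists h : C0 R X, forall x, h x = (f x)^*.
Proof.
apply: (@c0_dom _ _ f _ 1) => [x|x]; last by rewrite normc_conj mul1r.
by apply: continuous_comp; [exact: c0_continuous|exact: conjc_continuous].
Qed.

(** A sum, product or multiple is any [h] with the right values; [c0_add], [c0_mul] and [c0_scale]
    provide such an [h]. *)
Record c0_character (chi : C0 R X -> R[i]) := C0Character {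
  chiD : forall f g h : C0 R X, (forall x, h x = f x + g x) -> chi h = chi f + chi g;
  chiM : forall f g h : C0 R X, (forall x, h x = f x * g x) -> chi h = chi f * chi g;
  chiZ : forall c (f h : C0 R X), (forall x, h x = c * f x) -> chi h = c * chi f;
  chi_neq0 : exists f, chi f != 0 }.

Variable chi : C0 R X -> R[i].
Hypothesis chiP : c0_character chi.

Lemma mul_conjC (z : R[i]) : z * z^* = ((normc z ^+ 2)%:C)%C.
Proof. by rewrite -normCK -normc_normr rmorphXn. Qed.

Lemma character_unit : exists u, chi u = 1.
Proof.
have [f f0] := chi_neq0 chiP; have [u uE] := c0_scale (chi f)^-1 f.
by exists u; rewrite (chiZ chiP uE) mulVf.
Qed.

(* If no point evaluation vanishes on ker chi, then some F >= 0 in ker chi is at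
   least 1 where |u| >= 1/2, so |1 - u|^2 + F is bounded below.  Dividing u by
   it writes u as an element of C_0(X) (1 - u) + C_0(X) F, on which chi
   vanishes. *)
Lemma character_kernel : exists x, forall f, chi f = 0 -> f x = 0.
Proof.
have [u chiu] := character_unit; apply: contrapT => nx.
have loc x : exists f, chi f = 0 /\ f x != 0.
  apply: contrapT => nf; apply: nx; exists x => f chif.
  by apply/eqP; apply: contrapT => /negP fx; apply: nf; exists f.
have [z zE] := c0_scale 0 u.
pose Q (A : set X) := exists (F : C0 R X) (r : X -> R),
  [/\ chi F = 0, forall x, F x = ((r x)%:C)%C, forall x, 0 <= r x &
      forall x, A x -> 1 <= r x].
have half0 : (0 : R) < 1 / 2 by lra.
have [F [r [chiF FE r0 r1]]] : Q [set x | 1 / 2 <= normc (u x)].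
  apply: (compact_local (c0_vanish (c := u) half0)).
  - exists z, (fun=> 0); split => // [|x]; last by rewrite zE mul0r.
    by rewrite (chiZ chiP zE) mul0r.
  - by move=> A B AB [F [r [? ? ? h]]]; exists F, r; split => // x /AB; exact: h.
  - move=> A B [F [r [F1 F2 F3 F4]]] [F' [r' [F1' F2' F3' F4']]].
    have [S SE] := c0_add F F'; exists S, (fun x => r x + r' x); split.
    + by rewrite (chiD chiP SE) F1 F1' addr0.
    + by move=> x; rewrite SE F2 F2' rmorphD.
    + by move=> x; rewrite addr_ge0.
    + move=> x [/F4|/F4'] h; first by have := F3' x; lra.
      by have := F3 x; lra.
  - move=> x _; have [f [chif fx]] := loc x.
    have nf0 : normc (f x) != 0 by rewrite gt_eqF // normc_gt0.
    have [g gE] := c0_conj f.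
    (* The factor 2 gives [r x = 2], so [r] stays above 1 near [x]. *)
    pose c := 2 / normc (f x) ^+ 2.
    have [k kE] := c0_scale (c%:C)%C g; have [F FE] := c0_mul f k.
    pose r y := c * normc (f y) ^+ 2.
    have Fr y : F y = ((r y)%:C)%C.
      by rewrite FE kE gE mulrCA mul_conjC -rmorphM.
    exists [set y | 1 <= r y].
      have /continuous_normc/(_ x 1 ltr01) := @c0_continuous _ _ F.
      apply: filterS => y; rewrite !Fr -rmorphB normc_real.
      have -> : r x = 2 by rewrite /r /c mulfVK // expf_neq0.
      by rewrite ltr_norml => /andP[_ ?] /=; lra.
    exists F, r; split => //.
      by rewrite (chiM chiP FE) chif mul0r.
    by move=> y; rewrite mulr_ge0 ?sqr_ge0 // divr_ge0 ?sqr_ge0.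
pose g x := normc (1 - u x) ^+ 2 + r x.
(* Either [|u| >= 1/2] and then [r >= 1], or [|1 - u| >= 1/2], with square at least [1/4]. *)
have g4 x : 1 / 4 <= g x.
  rewrite /g; case: (lerP (1 / 2) (normc (u x))) => ux.
    by have := r1 _ ux; have := sqr_ge0 (normc (1 - u x)); lra.
  have h := le_normcD (1 - u x) (u x); rewrite subrK normc1 in h.
  have := r0 x; have : 1 / 2 <= normc (1 - u x) by lra.
  by nra.
pose G x := (1 - u x) * (1 - u x)^* + F x.
have Gg x : G x = ((g x)%:C)%C by rewrite /G mul_conjC FE -rmorphD.
have gp x : 0 < g x by rewrite (lt_le_trans _ (g4 x)) //; lra.
have g0 x : g x != 0 by rewrite gt_eqF.
have G0 x : G x != 0 by rewrite Gg fmorph_eq0.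
have c1u : continuous (fun x => 1 - u x).
  by move=> x; apply: cvgB; [exact: cvg_cst|exact: c0_continuous].
have c1u' : continuous (fun x => (1 - u x)^*).
  by move=> x; exact: (@continuous_comp _ _ _ (fun x => 1 - u x) (fun z => z^*) _ (c1u x) (@conjc_continuous R _)).
have cG : continuous G.
  by move=> x; apply: cvgD; [apply: cvgM; [exact: c1u|exact: c1u']|exact: c0_continuous].
have [v vE] : exists v : C0 R X, forall x, v x = u x * (G x)^-1.
  apply: (@c0_mulb _ _ u _ 4) => [x|x]; first by apply: cvgV; [exact: G0|exact: cG].
  rewrite Gg -fmorphV normc_real ger0_norm; last by rewrite invr_ge0 ltW.
  by rewrite -[leRHS]invrK lef_pV2 ?posrE; have := g4 x; lra.
have [M M0 uM] := c0_bounded u.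
have [w wE] : exists w : C0 R X, forall x, w x = v x * (1 - u x)^*.
  apply: (@c0_mulb _ _ v (fun x => (1 - u x)^*) (1 + M) c1u') => x; rewrite normc_conj.
  rewrite (le_trans (le_normcD _ _)) // normcN normc1.
  by have := uM x; lra.
have [p pE] := c0_mul w u; have [q qE] := c0_mul v F.
have [h hE] := c0_add w q.
(* Since [1 - u] need not vanish at infinity, [u = w (1 - u) + v F] is read as [u + w u = w + v F];
   applying [chi] yields [1 + chi w = chi w]. *)
have hE' x : h x = u x + p x.
  have vG : u x = v x * G x by rewrite vE mulfVK.
  by rewrite hE pE qE wE {2}vG /G; ring.
have := chiD chiP hE; rewrite (chiD chiP hE') (chiM chiP pE) (chiM chiP qE).
rewrite chiF chiu mulr0 mulr1 addr0 addrC => /eqP.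
by rewrite -subr_eq0 addrAC subrr add0r oner_eq0.
Qed.

(** As [f - chi f * u] is in the kernel of [chi], [f x = chi f * u x] for all [f]. Some function is
    1 at [x], so [u x] is nonzero and cancels when the formula is applied to the product of [f] and
    [u]. *)
Lemma character_eval (lcX : locally_compact [set: X]) (hausX : hausdorff_space X) :
  exists x, forall f, chi f = f x.
Proof.
have [u chiu] := character_unit; have [x kx] := character_kernel.
have fE f : f x = chi f * u x.
  have [h hE] := c0_scale (- chi f) u; have [s sE] := c0_add f h.
  have := kx s; rewrite (chiD chiP sE) (chiZ chiP hE) chiu mulr1 subrr.
  by move=> /(_ erefl) /eqP; rewrite sE hE mulNr subr_eq0 => /eqP.
have [e [ex _]] := @c0_urysohn R X lcX hausX x setT (filterT).
have ux0 : u x != 0.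
  by apply/eqP => ux; have /eqP := fE e; rewrite ux mulr0 ex oner_eq0.
exists x => f; have [s sE] := c0_mul f u.
have := fE s; rewrite (chiM chiP sE) chiu mulr1 sE => /(mulIf ux0) ->.
by [].
Qed.

End character.

(** * Orbit equivalences and groupoid isomorphisms *)

Section topological_freeness.
Context {G : groupType} {X : topologicalType} (aG : dynSys G X).
Hypothesis freeG : topologically_free aG.

Lemma act_homeo (g : G) : inverse_homeos (aG g) (aG g^-1%g).
Proof.
by split; try exact: act_continuous; move=> x; rewrite -actM ?mulVg ?mulgV act1.
Qed.

(** If [g] and [h] differ, freeness makes the points moved by [h^-1 g] dense, so one of them lies in
    the interior of the set where [g] and [h] agree. *)
Lemma free_near_inj (g h : G) (x : X) :
  (\forall y \near x, aG g y = aG h y) -> g = h.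
Proof.
move=> gh; apply: contrapT => ngh.
have nk : (h^-1 * g)%g <> 1%g.
  by move=> k1; apply: ngh; rewrite -[RHS]mulg1 -k1 mulVKg.
have [||y [/interior_subset/= ghy]] := freeG nk (O := [set y | aG g y = aG h y]^°).
- by exists x.
- exact: open_interior.
- by rewrite /= actM ghy -actM mulVg act1.
Qed.

End topological_freeness.

Section continuous_on_arrows.
Context {G H : groupType} {X : topologicalType}.

Lemma near_pair (a : discrete_topology G * X -> discrete_topology H) (g : G) (x : X) :
  continuous a -> \forall y \near x, a (g, y) = a (g, x).
Proof.
move=> ca; have ca' : continuous (fun y : X => a ((g : discrete_topology G), y)).
  move=> y; apply: (@continuous_comp _ _ _ (fun y : X => ((g : discrete_topology G), y)) a).
    exact: (cvg_pair (cvg_cst (g : discrete_topology G)) cvg_id).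
  exact: ca.
exact: (ca' x _ (discrete_set1 _)).
Qed.

End continuous_on_arrows.

(** * Cocycle identities of an orbit equivalence *)

Section orbit_equivalence_cocycle.
Context {G H : groupType} {X Y : topologicalType}.
Context (aG : dynSys G X) (aH : dynSys H Y).
Variables (phi : X -> Y) (psi : Y -> X).
Variables (a : discrete_topology G * X -> discrete_topology H)
          (b : discrete_topology H * Y -> discrete_topology G).
Hypotheses (homeo : inverse_homeos phi psi) (ca : continuous a) (cb : continuous b).
Hypothesis phiE : forall g x, phi (aG g x) = aH (a (g, x)) (phi x).
Hypothesis psiE : forall h y, psi (aH h y) = aG (b (h, y)) (psi y).

(** Near [x] the values of [a] and [b] are constant; applying [psi] to
    [phi (g y) = a (g, x) (phi y)] then shows that both sides move every [y] near [x] alike. *)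
Lemma cocycle_inverse (freeG : topologically_free aG) (g : G) (x : X) :
  b (a (g, x), phi x) = g.
Proof.
have [phiK psiK cphi cpsi] := homeo; apply: (free_near_inj freeG (x := x)).
have nb : \forall y \near x, b (a (g, x), phi y) = b (a (g, x), phi x).
  exact: (cphi x _ (near_pair _ _ cb)).
near=> y.
have <- : b (a (g, x), phi y) = b (a (g, x), phi x) by near: y.
have <- : a (g, y) = a (g, x) by near: y; exact: near_pair.
by have := psiE (a (g, y)) (phi y); rewrite -phiE !phiK => <-.
Unshelve. all: by end_near.
Qed.

(** For [y] near [x] both sides carry [phi y] to [phi (g h y)], and freeness of the action of [H]
    identifies them. *)
Lemma cocycleM (freeH : topologically_free aH) (g h : G) (x : X) :
  a ((g * h)%g, x) = ((a (g, aG h x) : H) * a (h, x))%g.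
Proof.
have [phiK psiK cphi cpsi] := homeo; apply: (free_near_inj freeH (x := phi x)).
pose Q y := aH (a ((g * h)%g, x)) (phi y) =
    aH ((a (g, aG h x) : H) * a (h, x))%g (phi y).
(* Nearness to [phi x] is pulled back along [psi] to nearness to [x], where [a] is locally
   constant. *)
suff nx : \forall y \near psi (phi x), Q y.
  have /= := cpsi _ _ nx; rewrite {1}/nbhs /=; apply: filterS => z /=.
  by rewrite /Q psiK.
rewrite phiK /Q.
have ng : \forall y \near x, a (g, aG h y) = a (g, aG h x).
  exact: (@act_continuous _ _ aG h x _ (near_pair _ _ ca)).
near=> y.
have <- : a ((g * h)%g, y) = a ((g * h)%g, x) by near: y; exact: near_pair.
have <- : a (h, y) = a (h, x) by near: y; exact: near_pair.
have <- : a (g, aG h y) = a (g, aG h x) by near: y.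
by rewrite actM -!phiE actM.
Unshelve. all: by end_near.
Qed.

End orbit_equivalence_cocycle.

Section orbit_equivalence_groupoid.
Context {G H : groupType} {X Y : topologicalType}.
Context (aG : dynSys G X) (aH : dynSys H Y).

Lemma coe_groupoid (freeG : topologically_free aG) (freeH : topologically_free aH) :
  continuously_orbit_equivalent aG aH ->
  topGroupoid_isomorphic (transformation_groupoid aG) (transformation_groupoid aH).
Proof.
move=> [phi [psi [a [b [homeo ca cb phiE psiE]]]]].
have [phiK psiK cphi cpsi] := homeo.
have homeo' : inverse_homeos psi phi by [].
have aM := cocycleM homeo ca phiE freeH.
pose F (c : discrete_topology G * X) : discrete_topology H * Y := (a c, phi c.2).
pose F' (c : discrete_topology H * Y) : discrete_topology G * X := (b c, psi c.2).
exists F, F', phi, psi; split => //.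
- split.
  + by move=> [g x]; rewrite /F /F' /= phiK (cocycle_inverse homeo ca cb phiE psiE freeG).
  + by move=> [h y]; rewrite /F /F' /= psiK (cocycle_inverse homeo' cb ca psiE phiE freeH).
  + move=> c; have c2 : phi d.2 @[d --> c] --> phi c.2.
      exact: (@continuous_comp _ _ _ snd phi c cvg_snd (cphi c.2)).
    exact: (cvg_pair (ca c) c2).
  + move=> c; have c2 : psi d.2 @[d --> c] --> psi c.2.
      exact: (@continuous_comp _ _ _ snd psi c cvg_snd (cpsi c.2)).
    exact: (cvg_pair (cb c) c2).
- by split=> // -[g x]; rewrite /= /tg_rng /= phiE.
- move=> x; rewrite /F /= /tg_unit; congr pair => /=.
  (* The cocycle identity at [g = h = 1] makes [a (1, x)] idempotent, hence trivial. *)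
  have := aM 1%g 1%g x; rewrite mulg1 act1 => /eqP.
  by rewrite -[X in X == _]mulg1 (inj_eq (mulgI _)) => /eqP <-.
- move=> [g x] [h y] /= xE; rewrite /F /tg_mul /=; congr pair.
  by rewrite aM xE.
Qed.

(** The group component of [F] is the cocycle: compatibility with source and range at one arrow
    [(g, x)] is the orbit relation. *)
Lemma groupoid_coe :
  topGroupoid_isomorphic (transformation_groupoid aG) (transformation_groupoid aH) ->
  continuously_orbit_equivalent aG aH.
Proof.
move=> [F [F' [f [f' [[FK F'K cF cF'] homeo [srcF rngF] _ _]]]]].
have [fK f'K cf cf'] := homeo.
exists f, f', (fun c => (F c).1), (fun c => (F' c).1); split => //.
- by move=> c; apply: continuous_comp; [exact: cF|exact: cvg_fst].
- by move=> c; apply: continuous_comp; [exact: cF'|exact: cvg_fst].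
- move=> g x; have /= <- := rngF (g, x); have /= <- := srcF (g, x).
  by [].
- move=> h y; have src := srcF (F' (h, y)); have rng := rngF (F' (h, y)).
  move: src rng; rewrite F'K /= /tg_src /tg_rng /= => src rng.
  by rewrite rng fK; congr (aG _ _); rewrite [y in f' y]src fK.
Qed.

End orbit_equivalence_groupoid.

(** * Operators on l2 *)

Section l2_theory.
Context {R : realType} {I : choiceType}.
Implicit Types xi eta : l2 R I.

Lemma l2_ext xi eta : (forall i, xi i = eta i) -> xi = eta.
Proof. by move=> h; apply: val_inj; apply/funext. Qed.

Lemma l2norm_ge0 xi : 0 <= l2norm xi.
Proof. exact: sqrtr_ge0. Qed.

Lemma sqsumE xi : sqsum xi = (l2norm xi ^+ 2)%:E.
Proof.
have := sqsum_ge0 xi; have /l2_predP := l2funP xi.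
rewrite /l2norm; case: (sqsum xi) => [r| |] //= _.
by rewrite lee_fin => r0; rewrite sqr_sqrtr.
Qed.

End l2_theory.

Section l2_estimates.
Context {R : realType} {I : choiceType}.
Implicit Types xi eta : l2 R I.

(** Squares are compared term by term. The reindexing [s] lets one estimate serve multiplication
    operators and translations alike. *)
Lemma l2norm_dom (J : choiceType) (zeta : l2 R J) xi (c : R) : 0 <= c ->
  (exists s : I -> J, bijective s /\
     forall i, normc (xi i) <= c * normc (zeta (s i))) ->
  l2norm xi <= c * l2norm zeta.
Proof.
move=> c0 [s [bs xz]]; rewrite -(@ler_pXn2r _ 2) ?nnegrE ?mulr_ge0 ?l2norm_ge0 //.
rewrite -lee_fin -sqsumE exprMn [leRHS]EFinM -sqsumE.
have -> : sqsum zeta = \esum_(i in [set: I]) ((normc (zeta (s i)) ^+ 2)%:E).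
  apply: reindex_esum; rewrite setTT_bijective; exact: bs.
apply: le_esumZ => [|i|i]; rewrite ?sqr_ge0 //=.
by rewrite -exprMn ler_pXn2r // nnegrE ?mulr_ge0 ?normc_ge0.
Qed.

Lemma l2norm_coord xi i : normc (xi i) <= l2norm xi.
Proof.
rewrite -(@ler_pXn2r _ 2) ?nnegrE ?l2norm_ge0 ?normc_ge0 // -lee_fin -sqsumE.
apply: esum_ge; exists [set i]; last by rewrite fsbig_set1.
by split; first exact: finite_set1.
Qed.

Lemma l2norm0 : l2norm (0 : l2 R I) = 0.
Proof.
apply/eqP; rewrite eq_le l2norm_ge0 andbT.
apply: (@le_trans _ _ (0 * l2norm (0 : l2 R I))); last by rewrite mul0r.
apply: l2norm_dom => //; exists id; split; first by exists id.
by move=> i; rewrite mul0r [l2fun 0 i]/(0 : R[i]) Normc.normc0.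
Qed.

(* The triangle inequality up to the factor 2, which is all that is needed to
   handle norm closures. *)
Lemma l2normD xi eta : l2norm (xi + eta) <= 2 * (l2norm xi + l2norm eta).
Proof.
have h : (sqsum (xi + eta)%R <= (2 * (l2norm xi ^+ 2 + l2norm eta ^+ 2))%R%:E)%E.
  have -> : (2 * (l2norm xi ^+ 2 + l2norm eta ^+ 2))%:E =
      (2%:E * (sqsum xi + sqsum eta))%E by rewrite !sqsumE.
  rewrite -esumD; [|by move=> i _; rewrite lee_fin sqr_ge0..].
  under [X in (_ <= _ * X)%E]eq_esum do rewrite -EFinD.
  apply: le_esumZ => // i; first by rewrite addr_ge0 ?sqr_ge0.
  rewrite sqr_ge0 /=.
  have := le_normcD (xi i) (eta i).
  have := normc_ge0 (xi i); have := normc_ge0 (eta i).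
  have := normc_ge0 (xi i + eta i).
  move: (normc (xi i + eta i)) (normc (xi i)) (normc (eta i)) => s x y.
  move=> s0 y0 x0 sxy; have : s ^+ 2 <= (x + y) ^+ 2.
    by rewrite ler_pXn2r // nnegrE addr_ge0.
  by have := sqr_ge0 (x - y); nra.
rewrite sqsumE lee_fin in h.
have x0 := l2norm_ge0 xi; have y0 := l2norm_ge0 eta.
rewrite -(@ler_pXn2r _ 2) ?nnegrE ?l2norm_ge0 //; last by rewrite mulr_ge0 // addr_ge0.
by apply: (le_trans h); nra.
Qed.

Lemma sqsum_delta (p : I) :
  sqsum (fun i => if i == p then 1 else 0 : R[i]) = 1%E.
Proof.
rewrite -[RHS](@esum_set1 R _ p (fun=> 1%E)) // esum_mkcond; apply: eq_esum => i _.
by rewrite in_set1; case: eqP => _; rewrite ?normc1 ?Normc.normc0 ?expr1n ?expr0n.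
Qed.

Lemma delta_subproof (p : I) :
  (fun i => if i == p then 1 else 0 : R[i]) \in @l2_pred R I.
Proof. by apply/l2_predP; rewrite sqsum_delta ltry. Qed.

Definition delta p : l2 R I := L2 (delta_subproof p).

Lemma l2norm_delta p : l2norm (delta p) = 1.
Proof. by rewrite /l2norm sqsum_delta /= sqrtr1. Qed.

Lemma opnorm_leD (S T : l2 R I -> l2 R I) (a b : R) :
  opnorm_le S a -> opnorm_le T b -> opnorm_le (S + T) (2 * (a + b)).
Proof.
move=> Sa Tb xi; apply: (le_trans (l2normD _ _)).
by rewrite -mulrA ler_wpM2l // mulrDl lerD.
Qed.

Lemma opnorm_le_mono (S : l2 R I -> l2 R I) (a b : R) :
  a <= b -> opnorm_le S a -> opnorm_le S b.
Proof.
by move=> ab Sa xi; apply: (le_trans (Sa xi)); rewrite ler_wpM2r // l2norm_ge0.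
Qed.

Lemma bounded_opD (S T : l2 R I -> l2 R I) :
  bounded_op S -> bounded_op T -> bounded_op (S + T).
Proof.
move=> [lS [a Sa]] [lT [b Tb]]; split; last by exists (2 * (a + b)); exact: opnorm_leD.
move=> c xi eta; rewrite ![(S + T) _]/(S _ + T _) lS lT.
by rewrite scalerDr addrACA.
Qed.

Lemma bounded_op0 : bounded_op (0 : l2 R I -> l2 R I).
Proof.
split; first by move=> c xi eta; rewrite ![(0 : l2 R I -> _) _]/(0 : l2 R I) scaler0 addr0.
by exists 0 => xi; rewrite mul0r [l2norm _]l2norm0.
Qed.

Lemma bounded_op_comp (S T : l2 R I -> l2 R I) :
  bounded_op S -> bounded_op T -> bounded_op (S \o T).
Proof.
move=> [lS [a Sa]] [lT [b Tb]]; split; first by move=> c xi eta; rewrite /= lT lS.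
exists (`|a| * b) => xi /=; apply: (le_trans (Sa _)).
apply: (@le_trans _ _ (`|a| * l2norm (T xi))).
  by rewrite ler_wpM2r ?l2norm_ge0 // ler_norm.
by rewrite -mulrA ler_wpM2l.
Qed.

Section norm_closure.
Variable A : set (l2 R I -> l2 R I).

Lemma norm_closure_sub T : bounded_op T -> A T -> norm_closure A T.
Proof.
move=> bT AT; split=> // e e0; exists T => // xi.
by rewrite subrr [l2norm _]l2norm0 mulr_ge0 ?l2norm_ge0 // ltW.
Qed.

(** Two errors of [e / 4], with the factor 2 of [opnorm_leD], add up to [e]. Approximants may thus
    be taken in the closure itself, as the transport of generators requires. *)
Lemma norm_closure_closed T : bounded_op T ->
  (forall e : R, 0 < e -> exists2 S, norm_closure A S & opnorm_le (T - S) e) ->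
  norm_closure A T.
Proof.
move=> bT h; split=> // e e0; have e4 : 0 < e / 4 by lra.
have [S [_ cS] TS] := h _ e4; have [U AU SU] := cS _ e4; exists U => //.
have -> : T - U = (T - S) + (S - U) by rewrite addrA subrK.
by apply: opnorm_le_mono (opnorm_leD TS SU); lra.
Qed.

Lemma norm_closureD : (forall S T, A S -> A T -> A (S + T)) ->
  forall S T, norm_closure A S -> norm_closure A T -> norm_closure A (S + T).
Proof.
move=> AD S T [bS cS] [bT cT]; split; first exact: bounded_opD.
move=> e e0; have e4 : 0 < e / 4 by lra.
have [S' AS' SS'] := cS _ e4; have [T' AT' TT'] := cT _ e4.
exists (S' + T'); first exact: AD.
have -> : S + T - (S' + T') = (S - S') + (T - T') by rewrite opprD addrACA.
by apply: opnorm_le_mono (opnorm_leD SS' TT'); lra.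
Qed.

End norm_closure.

End l2_estimates.

(** * Unitaries induced by bijections of the basis *)

Section pullback.
Context {R : realType} {I J : choiceType} (s : J -> I) (t : I -> J).
Hypotheses (sK : cancel s t) (tK : cancel t s).

Lemma pull_subproof (xi : l2 R I) : (fun j => xi (s j)) \in @l2_pred R J.
Proof.
apply/l2_predP; have /l2_predP := l2funP xi; rewrite /sqsum.
rewrite (@reindex_esum R _ _ setT setT s) // setTT_bijective.
by exists t.
Qed.

Definition pull (xi : l2 R I) : l2 R J := L2 (pull_subproof xi).

Lemma l2norm_pull xi : l2norm (pull xi) = l2norm xi.
Proof.
congr (Num.sqrt (fine _)); rewrite /sqsum (@reindex_esum R _ _ setT setT s) //.
by rewrite setTT_bijective; exists t.
Qed.

Lemma partial_sum_image (V : zmodType) (x : I -> V) (A : {fset J}) :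
  partial_sum (fun j => x (s j)) A = partial_sum x (s @` A)%fset.
Proof.
rewrite /partial_sum -(big_seq_fsetE _ _ predT x) -(big_seq_fsetE _ _ predT (fun j => x (s j))) /=.
by rewrite big_imfset //= => i j _ _; exact: can_inj sK i j.
Qed.

(** A finite set containing the image of [A] under [t] has an image under [s] containing [A], so the
    reindexed partial sums also end up in [Z]. *)
Lemma totally_pull (V : zmodType) (x : I -> V) (Z : set V) :
  (partial_sum x @ totally) Z -> (partial_sum (fun j => x (s j)) @ totally) Z.
Proof.
move=> [A _ AZ]; exists (t @` A)%fset => // B /= tAB.
rewrite partial_sum_image; apply: AZ; apply/fsubsetP => i iA.
rewrite -(tK i); apply: in_imfset; apply: (fsubsetP tAB).
exact: in_imfset.
Qed.

End pullback.

Section conjugation.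
Context {R : realType} {I J : choiceType} (s : J -> I) (t : I -> J).
Hypotheses (sK : cancel s t) (tK : cancel t s).

(** Both nets of partial sums generate the same filter, hence have the same [lim], whether or not
    convergence is known. *)
Lemma l2inner_pull (xi eta : l2 R I) :
  l2inner (pull sK tK xi) (pull sK tK eta) = l2inner xi eta.
Proof.
rewrite /l2inner /summability.sum; congr lim.
set x := fun i => _; set y := fun i => _.
have xE : x = y \o s by [].
have yE : y = x \o t by apply/funext => i /=; rewrite /x /y /= tK.
apply/seteqP; split => Z h.
  by rewrite yE; exact: (totally_pull tK sK h).
by rewrite xE; exact: (totally_pull sK tK h).
Qed.

Lemma pullK (xi : l2 R I) : pull tK sK (pull sK tK xi) = xi.
Proof. by apply: l2_ext => i /=; rewrite tK. Qed.

Definition conj_op (T : l2 R I -> l2 R I) (eta : l2 R J) : l2 R J :=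
  pull sK tK (T (pull tK sK eta)).

Lemma opnorm_le_conj T (a : R) : opnorm_le T a -> opnorm_le (conj_op T) a.
Proof. by move=> Ta eta; rewrite l2norm_pull (le_trans (Ta _)) // l2norm_pull. Qed.

Lemma conj_opD S T : conj_op (S + T) = conj_op S + conj_op T.
Proof. by apply/funext => eta; apply: l2_ext. Qed.

Lemma conj_opB S T : conj_op (S - T) = conj_op S - conj_op T.
Proof. by apply/funext => eta; apply: l2_ext. Qed.

Lemma conj_op0 : conj_op 0 = 0.
Proof. by apply/funext => eta; apply: l2_ext. Qed.

Lemma conj_opZ c T : conj_op (c *: T) = c *: conj_op T.
Proof. by apply/funext => eta; apply: l2_ext. Qed.

Lemma bounded_op_conj T : bounded_op T -> bounded_op (conj_op T).
Proof.
move=> [lT [a Ta]]; split; last by exists a; exact: opnorm_le_conj.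
move=> c xi eta; rewrite /conj_op.
have -> : pull tK sK (c *: xi + eta) = c *: pull tK sK xi + pull tK sK eta by apply: l2_ext.
by rewrite lT; apply: l2_ext.
Qed.

End conjugation.

Section conjugation_inverse.
Context {R : realType} {I J : choiceType} (s : J -> I) (t : I -> J).
Hypotheses (sK : cancel s t) (tK : cancel t s).

Lemma conj_op_comp (S T : l2 R I -> l2 R I) :
  conj_op sK tK (S \o T) = conj_op sK tK S \o conj_op sK tK T.
Proof. by apply/funext => eta; rewrite /conj_op /= pullK. Qed.

Lemma conj_opK (T : l2 R I -> l2 R I) : conj_op tK sK (conj_op sK tK T) = T.
Proof. by apply/funext => xi; rewrite /conj_op !pullK. Qed.

Lemma is_adjoint_conj (S T : l2 R I -> l2 R I) :
  is_adjoint S T -> is_adjoint (conj_op sK tK S) (conj_op sK tK T).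
Proof.
move=> ST xi eta; rewrite -{1}[eta](pullK tK sK) -{2}[xi](pullK tK sK) !l2inner_pull.
exact: ST.
Qed.

End conjugation_inverse.

(** * From groupoids to crossed products *)

Section crossed_product_operators.
Context {R : realType} {G : groupType} {X : topologicalType} (aG : dynSys G X).
Local Notation Hilb := (l2 R (G * X)%type).
Implicit Types (f : C0 R X) (g h : G) (xi : Hilb).

Lemma opnorm_le_pi f (M : R) : 0 <= M -> (forall x, normc (f x) <= M) ->
  opnorm_le (regular_pi aG f) M.
Proof.
move=> M0 fM xi; apply: l2norm_dom => //; exists id; split; first by exists id.
by move=> p; rewrite Normc.normcM ler_wpM2r // normc_ge0.
Qed.

Lemma bounded_op_pi f : bounded_op (regular_pi aG f).
Proof.
split; last by have [M M0 fM] := c0_bounded f; exists M; exact: opnorm_le_pi.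
move=> c xi eta; apply: l2_ext => p; set z := f (aG p.1 p.2).
have h : z * (c * xi p + eta p) = c * (z * xi p) + z * eta p.
  by rewrite mulrDr mulrCA.
exact: h.
Qed.

Lemma opnorm_le_lambda h : opnorm_le (@regular_lambda R G X h) 1.
Proof.
move=> xi; apply: l2norm_dom => //.
exists (fun p : G * X => ((h^-1 * p.1)%g, p.2)); split.
  by exists (fun p : G * X => ((h * p.1)%g, p.2)) => -[k x] /=; rewrite ?mulKg ?mulVKg.
by move=> p; rewrite mul1r.
Qed.

Lemma bounded_op_lambda h : bounded_op (@regular_lambda R G X h).
Proof.
split; last by exists 1; exact: opnorm_le_lambda.
by move=> c xi eta; apply: l2_ext.
Qed.

Lemma regular_lambda1 xi : regular_lambda 1%g xi = xi.
Proof. by apply: l2_ext => -[g x] /=; rewrite invg1 mul1g. Qed.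

Lemma sum_opE (T : Type) (s : seq T) (F : T -> Hilb -> Hilb) xi p :
  (\sum_(t <- s) F t) xi p = \sum_(t <- s) F t xi p.
Proof.
elim: s => [|t s IH]; first by rewrite !big_nil.
by rewrite !big_cons -IH.
Qed.

Lemma algebraicD (S T : Hilb -> Hilb) : algebraic_crossed_product aG S ->
  algebraic_crossed_product aG T -> algebraic_crossed_product aG (S + T).
Proof. by move=> [s ->] [t ->]; exists (s ++ t); rewrite big_cat. Qed.

Lemma reducedD (S T : Hilb -> Hilb) : reduced_crossed_product R aG S ->
  reduced_crossed_product R aG T -> reduced_crossed_product R aG (S + T).
Proof. by apply: norm_closureD; exact: algebraicD. Qed.

Lemma algebraic_bounded (T : Hilb -> Hilb) :
  algebraic_crossed_product aG T -> bounded_op T.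
Proof.
move=> [s ->]; elim: s => [|t s IH]; first by rewrite big_nil; exact: bounded_op0.
rewrite big_cons; apply: bounded_opD => //.
by apply: bounded_op_comp; [exact: bounded_op_pi|exact: bounded_op_lambda].
Qed.

Lemma algebraic_reduced (T : Hilb -> Hilb) :
  algebraic_crossed_product aG T -> reduced_crossed_product R aG T.
Proof.
by move=> aT; apply: norm_closure_sub => //; exact: algebraic_bounded.
Qed.

Lemma generator_reduced f g :
  reduced_crossed_product R aG (regular_pi aG f \o regular_lambda g).
Proof. by apply: algebraic_reduced; exists [:: (f, g)]; rewrite big_seq1. Qed.

Lemma pi_reduced f : reduced_crossed_product R aG (regular_pi aG f).
Proof.
have -> : regular_pi aG f = regular_pi aG f \o regular_lambda 1%g.
  by apply/funext => xi /=; rewrite regular_lambda1.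
exact: generator_reduced.
Qed.

Lemma algebraic_eval (s : seq (C0 R X * G)) xi (p : G * X) :
  (\sum_(t <- s) (regular_pi aG t.1 \o regular_lambda t.2)) xi p =
  \sum_(t <- s) t.1 (aG p.1 p.2) * xi ((t.2^-1 * p.1)%g, p.2).
Proof. by rewrite sum_opE. Qed.

End crossed_product_operators.

Section transport.
Context {R : realType} {G H : groupType} {X Y : topologicalType}.
Context (aG : dynSys G X) (aH : dynSys H Y).
Variables (F : discrete_topology G * X -> discrete_topology H * Y)
  (F' : discrete_topology H * Y -> discrete_topology G * X)
  (f : X -> Y) (f' : Y -> X).
Hypotheses (FK : cancel F F') (F'K : cancel F' F) (cF : continuous F).
Hypothesis homeof : inverse_homeos f f'.
Hypothesis rngF : forall c, aH (F c).1 (F c).2 = f (aG c.1 c.2).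
Hypothesis mulF : forall c d, c.2 = aG d.1 d.2 -> F (tg_mul c d) = tg_mul (F c) (F d).

Local Notation conjF := (@conj_op R (G * X)%type (H * Y)%type F' F F'K FK).

Lemma rngF' c : aG (F' c).1 (F' c).2 = f' (aH c.1 c.2).
Proof. by have := rngF (F' c); rewrite F'K => ->; case: homeof => ->. Qed.

(** [regular_pi] multiplies at each arrow by the value of the function at its range, and [F'] acts
    on ranges as [f']. *)
Lemma conj_pi (u : C0 R X) (v : C0 R Y) : (forall y, v y = u (f' y)) ->
  conjF (regular_pi aG u) = regular_pi aH v.
Proof.
move=> vu; apply/funext => eta; apply: l2_ext => p /=.
by rewrite rngF' vu F'K.
Qed.

(** The pointwise inverse of the cocycle function c of the overview: on arrows with range [z], the
    conjugate of [regular_lambda g] shifts the argument by left multiplication with [cut g z]. *)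
Let cut (g : G) (z : Y) : discrete_topology H := (F (g^-1%g : G, f' z)).1.

Let cut_continuous g : continuous (cut g).
Proof.
case: homeof => _ _ _ cf' z.
apply: (@continuous_comp _ _ _ (fun z => F (g^-1%g : G, f' z)) fst); last exact: cvg_fst.
apply: (@continuous_comp _ _ _ (fun z => ((g^-1%g : discrete_topology G), f' z)) F).
  exact: (cvg_pair (cvg_cst (g^-1%g : discrete_topology G)) (cf' z)).
exact: cF.
Qed.

(** [regular_lambda g] composes each arrow on the left with one of group part [g^-1], and [F]
    respects this composition. *)
Lemma conj_generatorE (u : C0 R X) (g : G) eta p :
  conjF (regular_pi aG u \o regular_lambda g) eta p =
  u (f' (aH p.1 p.2)) * eta (((cut g (aH p.1 p.2) : H) * p.1)%g, p.2).
Proof.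
rewrite /= rngF'; congr (_ * eta _).
have -> : ((g^-1 * (F' p).1)%g, (F' p).2) =
    tg_mul ((g^-1%g : discrete_topology G), f' (aH p.1 p.2)) (F' p) by [].
by rewrite mulF ?F'K // -rngF'.
Qed.

(* The function u o f' is cut along the clopen sets on which the cocycle is
   constant; those meeting {|u o f'| >= e} are finitely many, and dropping the
   others costs at most e. *)
Lemma conj_generator (u : C0 R X) (g : G) :
  reduced_crossed_product R aH (conjF (regular_pi aG u \o regular_lambda g)).
Proof.
have homeof' : inverse_homeos f' f by case: homeof.
have [v vE] := c0_comp u homeof'.
apply: norm_closure_closed.
  apply: bounded_op_conj; apply: bounded_op_comp; first exact: bounded_op_pi.
  exact: bounded_op_lambda.
move=> e e0.
have [s0 s0P] := compact_finite_values (c0_vanish (c := v) e0) (@cut_continuous g).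
pose s := undup s0.
have [w wE] := choice (fun h : H => @c0_indic R Y v H (cut g) h (@cut_continuous g)).
(* [regular_lambda] shifts by the inverse, so the piece where [cut g] equals [h] is paired with
   [h^-1]. *)
exists (\sum_(t <- [seq (w h, h^-1%g) | h <- s]) (regular_pi aH t.1 \o regular_lambda t.2)).
  by apply: algebraic_reduced; exists [seq (w h, h^-1%g) | h <- s].
move=> eta; set S := \sum_(_ <- _) _.
have SE p : S eta p = if (cut g (aH p.1 p.2) : H) \in s
    then v (aH p.1 p.2) * eta (((cut g (aH p.1 p.2) : H) * p.1)%g, p.2) else 0.
  rewrite /S algebraic_eval big_map /=; set k : H := cut g _.
  transitivity (\sum_(h <- s | h == k) v (aH p.1 p.2) * eta ((k * p.1)%g, p.2)).
    rewrite [RHS]big_mkcond; apply: eq_bigr => h _; rewrite wE invgK -/k eq_sym.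
    by case: eqP => [->|]; rewrite ?mul0r.
  case: ifPn => ks.
    rewrite -big_filter; have -> : [seq h <- s | h == k] = [:: k].
      by apply: perm_small_eq; rewrite // filter_pred1_uniq ?undup_uniq.
    by rewrite big_seq1.
  by rewrite big_seq_cond big1 // => h /andP[hs /eqP hk]; rewrite -hk hs in ks.
(* The error is 0 on the listed values of [cut g]. Elsewhere [|v| < e], and the error is [v] times
   the translated vector, whose norm is at most that of [eta]. *)
apply: (@le_trans _ _ (e * l2norm (conjF (@regular_lambda R G X g) eta))); last first.
  rewrite ler_wpM2l ?(ltW e0) // -[leRHS]mul1r.
  exact: opnorm_le_conj (@opnorm_le_lambda R G X g) eta.
apply: l2norm_dom (ltW e0) _; exists id; split; first by exists id.
move=> p; set c := conjF (@regular_lambda R G X g) eta p.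
have cE : c = eta (((cut g (aH p.1 p.2) : H) * p.1)%g, p.2).
  rewrite /c /= ; congr (eta _).
  have -> : ((g^-1 * (F' p).1)%g, (F' p).2) =
      tg_mul ((g^-1%g : discrete_topology G), f' (aH p.1 p.2)) (F' p) by [].
  by rewrite mulF ?F'K // -rngF'.
have -> : (conjF (regular_pi aG u \o regular_lambda g) - S) eta p =
    v (aH p.1 p.2) * c - S eta p.
  by rewrite cE vE -conj_generatorE.
rewrite SE -cE; case: ifPn => [_|ns].
  by rewrite subrr Normc.normc0 mulr_ge0 ?normc_ge0 ?ltW.
rewrite subr0 Normc.normcM ler_wpM2r ?normc_ge0 // leNgt; apply/negP => ve.
by move: ns; rewrite /s mem_undup s0P //= ltW.
Qed.

Lemma conj_reduced T : reduced_crossed_product R aG T ->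
  reduced_crossed_product R aH (conjF T).
Proof.
move=> [bT cT]; apply: norm_closure_closed; first exact: bounded_op_conj.
move=> e e0; have [S [s ->] TS] := cT e e0.
exists (conjF (\sum_(p <- s) (regular_pi aG p.1 \o regular_lambda p.2))); last first.
  by rewrite -conj_opB; exact: opnorm_le_conj.
elim: s {TS} => [|p s IH].
  rewrite big_nil conj_op0; apply: algebraic_reduced; exists [::].
  by rewrite big_nil.
by rewrite big_cons conj_opD; apply: (reducedD (conj_generator _ _) IH).
Qed.

End transport.

Lemma groupoid_cstar (R : realType) (G H : groupType) (X Y : topologicalType)
    (aG : dynSys G X) (aH : dynSys H Y) :
  topGroupoid_isomorphic (transformation_groupoid aG) (transformation_groupoid aH) ->
  exists Phi,
    cstar_isomorphism (reduced_crossed_product R aG)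
                      (reduced_crossed_product R aH) Phi /\
    Phi @` C0_in_crossed_product R aG = C0_in_crossed_product R aH.
Proof.
move=> [F [F' [f [f' [homeoF homeof [srcF rngF] _ mulF]]]]].
have homeof' : inverse_homeos f' f by case: homeof.
have [FK F'K cF cF'] := homeoF; have [ffK f'fK _ _] := homeof.
(* [F'] also respects sources, ranges and products, so [conj_reduced] applies to it and gives
   surjectivity of the conjugation. *)
have srcF' c : (F' c).2 = f' c.2.
  by have := srcF (F' c); rewrite F'K => /(congr1 f'); rewrite ffK.
have rngF'' c : aG (F' c).1 (F' c).2 = f' (aH c.1 c.2).
  by have := rngF (F' c); rewrite F'K => /(congr1 f'); rewrite ffK.
have mulF' c d : c.2 = aH d.1 d.2 -> F' (tg_mul c d) = tg_mul (F' c) (F' d).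
  move=> cd; apply: (can_inj FK); rewrite F'K [RHS]mulF ?F'K //.
  by rewrite [LHS]srcF' cd -rngF''.
exists (conj_op F'K FK); split.
  split.
  - split.
    + by move=> T; exact: (conj_reduced FK F'K cF homeof rngF mulF).
    + move=> S T _ _ /(congr1 (conj_op FK F'K)).
      by rewrite !conj_opK.
    + move=> T rT; exists (conj_op FK F'K T).
        exact: (conj_reduced F'K FK cF' homeof' rngF'' mulF').
      by rewrite conj_opK.
  - by move=> S T _ _; exact: conj_opD.
  - by move=> c T _; exact: conj_opZ.
  - by move=> S T _ _; exact: conj_op_comp.
  - by move=> S T _ _; exact: is_adjoint_conj.
apply/seteqP; split => [_ [_ [u _ <-] <-]|_ [v _ <-]].
  have [v vE] := c0_comp u homeof'; exists v => //.
  by rewrite (conj_pi FK F'K homeof rngF vE).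
have [u uE] := c0_comp v homeof; exists (regular_pi aG u); first by exists u.
by apply: (conj_pi FK F'K homeof rngF) => y; rewrite uE f'fK.
Qed.

(** * From crossed products to orbit equivalences *)

Section gelfand.
Context {R : realType} {X Y : topologicalType}.
Hypotheses (lcX : locally_compact [set: X]) (hausX : hausdorff_space X).
Hypotheses (lcY : locally_compact [set: Y]) (hausY : hausdorff_space Y).

Definition c0_morphism (theta : C0 R X -> C0 R Y) :=
  [/\ forall f g h : C0 R X, (forall x, h x = f x + g x) ->
        forall y, theta h y = theta f y + theta g y,
      forall f g h : C0 R X, (forall x, h x = f x * g x) ->
        forall y, theta h y = theta f y * theta g y &
      forall c (f h : C0 R X), (forall x, h x = c * f x) ->
        forall y, theta h y = c * theta f y].

(** For each [y], [u |-> theta u y] is a character, nonzero because [theta] is surjective, hence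
    evaluation at a point [psi y]. *)
Lemma gelfand (theta : C0 R X -> C0 R Y) :
  c0_morphism theta -> (forall v, exists u, theta u = v) ->
  exists2 psi : Y -> X, continuous psi & forall u y, theta u y = u (psi y).
Proof.
move=> [tD tM tZ] tS.
have ev y : exists x, forall u, theta u y = u x.
  apply: (@character_eval R X (fun u => theta u y)) => //; split.
  - by move=> f g h hE; exact: tD.
  - by move=> f g h hE; exact: tM.
  - by move=> c f h hE; exact: tZ.
  - have [v [vy _]] := @c0_urysohn R Y lcY hausY y setT filterT.
    by have [u uv] := tS v; exists u; rewrite uv vy oner_eq0.
have [psi psiE] := choice ev; exists psi; last by move=> u y; exact: psiE.
apply: (@continuous_c0 R X lcX hausX) => u y.
have -> : (fun y => u (psi y)) = theta u by apply/funext => z; rewrite psiE.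
exact: c0_continuous.
Qed.

End gelfand.

Lemma continuous_sumc (R : realType) (X : topologicalType) (T : Type) (s : seq T)
    (F : T -> X -> R[i]) : (forall t, continuous (F t)) ->
  continuous (fun x => \sum_(t <- s) F t x).
Proof.
move=> cF; elim: s => [|t s IH].
  have -> : (fun x => \sum_(t <- [::]) F t x) = cst 0.
    by apply/funext => x; rewrite big_nil.
  by move=> x; exact: cvg_cst.
have -> : (fun x => \sum_(i <- t :: s) F i x) = fun x => F t x + \sum_(i <- s) F i x.
  by apply/funext => x; rewrite big_cons.
by move=> x; apply: cvgD; [exact: cF|exact: IH].
Qed.

(** * Matrix coefficients at the vectors of the units *)

Section reduced_coefficients.
Context {R : realType} {G : groupType} {X : topologicalType} (aG : dynSys G X).
Local Notation Hilb := (l2 R (G * X)%type).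
Local Notation delta1 x := (delta (1%g : G, x) : Hilb).

Lemma linear_op0 (T : Hilb -> Hilb) : bounded_op T -> T 0 = 0.
Proof.
move=> [lT _]; have := lT (-1) 0 0.
by rewrite scaler0 addr0 scaleN1r addNr.
Qed.

Lemma linear_opZ (T : Hilb -> Hilb) c xi : bounded_op T -> T (c *: xi) = c *: T xi.
Proof.
move=> bT; have [lT _] := bT.
have h : T (c *: xi + 0) = c *: T xi + T 0 by exact: lT.
by rewrite (linear_op0 bT) !addr0 in h.
Qed.

Lemma pi_delta (f : C0 R X) (x : X) :
  regular_pi aG f (delta1 x) = f x *: delta1 x.
Proof.
apply: l2_ext => p; have h : f (aG p.1 p.2) * delta1 x p = f x * delta1 x p.
  by rewrite /=; case: eqP => [->|]; rewrite ?mulr0 // act1.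
exact: h.
Qed.

Lemma pi_coef (f : C0 R X) (x : X) : regular_pi aG f (delta1 x) (1%g, x) = f x.
Proof. by rewrite /= eqxx act1 mulr1. Qed.

Lemma algebraic_coef (s : seq (C0 R X * G)) (x x' : X) (g : G) :
  (\sum_(t <- s) (regular_pi aG t.1 \o regular_lambda t.2)) (delta1 x) (g, x') =
  \sum_(t <- s) t.1 (aG g x') *
    (if ((t.2^-1 * g)%g == 1%g) && (x' == x) then 1 else 0).
Proof. by rewrite algebraic_eval; apply: eq_bigr => t _. Qed.

Lemma coef_approx (S T : Hilb -> Hilb) (e : R) (x : X) (p : G * X) :
  opnorm_le (T - S) e -> normc (T (delta1 x) p - S (delta1 x) p) <= e.
Proof.
move=> /(_ (delta1 x)); rewrite l2norm_delta mulr1; apply: le_trans.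
exact: (l2norm_coord ((T - S) (delta1 x)) p).
Qed.

(** Finite sums keep the basis vector at [(1, x)] among the arrows with source [x], and vanishing
    coefficients survive norm limits. *)
Lemma reduced_coef_off (T : Hilb -> Hilb) (x x' : X) (g : G) :
  reduced_crossed_product R aG T -> x' <> x -> T (delta1 x) (g, x') = 0.
Proof.
move=> [_ cT] /eqP/negbTE xx'; apply: Normc.eq0_normc; apply/eqP.
rewrite eq_le normc_ge0 andbT; apply/ler_addgt0Pr => e e0; rewrite add0r.
have [S [s ->] TS] := cT e e0; have := coef_approx x (g, x') TS.
rewrite algebraic_coef big1 ?subr0 // => t _.
by rewrite xx' andbF mulr0.
Qed.

(** The coefficient is a uniform limit of those of finite sums, which are finite sums of continuous
    functions [t.1 o g]. *)
Lemma reduced_coef_continuous (T : Hilb -> Hilb) (g : G) :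
  reduced_crossed_product R aG T -> continuous (fun x => T (delta1 x) (g, x)).
Proof.
move=> [_ cT]; apply/continuous_normc => x e e0.
have e3 : 0 < e / 3 by lra.
have [_ [s ->] TS] := cT _ e3.
set S := \sum_(_ <- _) _ in TS.
have : continuous (fun x => S (delta1 x) (g, x)).
  have -> : (fun x => S (delta1 x) (g, x)) = fun x =>
      \sum_(t <- s) t.1 (aG g x) * (if (t.2^-1 * g)%g == 1%g then 1 else 0).
    apply/funext => y; rewrite /S algebraic_coef.
    by apply: eq_bigr => t _; rewrite eqxx andbT.
  apply: continuous_sumc => t y.
  apply: cvgM; last exact: cvg_cst.
  apply: (@continuous_comp _ _ _ (aG g) t.1); first exact: act_continuous.
  exact: c0_continuous.
move/continuous_normc => /(_ x _ e3); apply: filterS => y.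
have := coef_approx x (g, x) TS; have := coef_approx y (g, y) TS.
move: (T (delta1 y) _) (S (delta1 y) _) (T (delta1 x) _) (S (delta1 x) _).
move=> ty sy tx sx hy hx hs.
have -> : tx - ty = (tx - sx) + (sx - sy) + (sy - ty).
  by ring.
apply: (le_lt_trans (le_normcD _ _)).
have := le_normcD (tx - sx) (sx - sy).
by have := normcN (ty - sy); rewrite opprB => ->; lra.
Qed.

End reduced_coefficients.

(** * Products in the reduced crossed product *)

Section reduced_composition.
Context {R : realType} {G : groupType} {X : topologicalType} (aG : dynSys G X).
Local Notation Hilb := (l2 R (G * X)%type).

(** Covariance: moving [regular_lambda g] past [regular_pi v] replaces [v] by [v o g^-1], so [w] is
    [u] times [v o g^-1]. *)
Lemma generator_comp (u v : C0 R X) (g h : G) :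
  exists w : C0 R X, (regular_pi aG u \o regular_lambda g) \o
    (regular_pi aG v \o regular_lambda h) = regular_pi aG w \o regular_lambda (g * h)%g.
Proof.
have hg : inverse_homeos (aG g^-1%g) (aG g) by case: (act_homeo aG g).
have [v' v'E] := c0_comp v hg; have [w wE] := c0_mul u v'.
exists w; apply/funext => xi; apply: l2_ext => p /=.
by rewrite wE v'E mulrA actM invgM mulgA.
Qed.

Lemma algebraic_comp (S T : Hilb -> Hilb) : algebraic_crossed_product aG S ->
  algebraic_crossed_product aG T -> algebraic_crossed_product aG (S \o T).
Proof.
have a0 : algebraic_crossed_product aG (0 : Hilb -> Hilb) by exists [::]; rewrite big_nil.
move=> [s ->] [t ->]; elim: s => [|a s IHs]; first by rewrite big_nil.
rewrite big_cons; have -> (A B C : Hilb -> Hilb) : (A + B) \o C = (A \o C) + (B \o C) by [].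
apply: algebraicD => //; elim: t {s IHs} => [|b t IHt].
  rewrite big_nil; have -> : (regular_pi aG a.1 \o regular_lambda a.2) \o (0 : Hilb -> Hilb) =
      (0 : Hilb -> Hilb) => //.
  apply/funext => xi; apply: (@linear_op0 R G X (regular_pi aG a.1 \o @regular_lambda R G X a.2)).
  by apply: bounded_op_comp; [exact: bounded_op_pi|exact: bounded_op_lambda].
rewrite big_cons.
(* Unlike distributivity on the other side, this uses linearity of the generator. *)
have -> (B C : Hilb -> Hilb) : (regular_pi aG a.1 \o regular_lambda a.2) \o (B + C) =
    ((regular_pi aG a.1 \o regular_lambda a.2) \o B) +
    ((regular_pi aG a.1 \o regular_lambda a.2) \o C).
  apply/funext => xi; have [la _] : bounded_op (regular_pi aG a.1 \o @regular_lambda R G X a.2).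
    by apply: bounded_op_comp; [exact: bounded_op_pi|exact: bounded_op_lambda].
  by have := la 1 (B xi) (C xi); rewrite !scale1r.
apply: algebraicD => //; have [w ->] := generator_comp a.1 b.1 a.2 b.2.
by exists [:: (w, (a.2 * b.2)%g)]; rewrite big_seq1.
Qed.

Lemma opnorm_le_comp (S T : Hilb -> Hilb) (a b : R) : 0 <= a ->
  opnorm_le S a -> opnorm_le T b -> opnorm_le (S \o T) (a * b).
Proof.
by move=> a0 Sa Tb xi; apply: (le_trans (Sa _)); rewrite -mulrA ler_wpM2l.
Qed.

Lemma bounded_op_pos (S : Hilb -> Hilb) : bounded_op S -> exists2 a, 0 < a & opnorm_le S a.
Proof.
move=> [_ [a Sa]]; exists (1 + `|a|); first by rewrite ltr_pwDl.
by apply: opnorm_le_mono Sa; rewrite (le_trans (ler_norm a)) // lerDr.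
Qed.

(** In [S T - S' T' = S (T - T') + (S - S') T'] the tolerance for [S'] depends on a bound for [T'],
    which is chosen first. Stability under products is what makes the inverse isomorphism
    multiplicative in [cstar_coe]. *)
Lemma reduced_comp (S T : Hilb -> Hilb) : reduced_crossed_product R aG S ->
  reduced_crossed_product R aG T -> reduced_crossed_product R aG (S \o T).
Proof.
move=> [bS cS] [bT cT]; split; first exact: bounded_op_comp.
move=> e e0; have [a a0 Sa] := bounded_op_pos bS.
have ea : 0 < e / 4 / a by rewrite !divr_gt0.
have [T' AT' TT'] := cT _ ea.
have [b b0 Tb] := bounded_op_pos (algebraic_bounded AT').
have eb : 0 < e / 4 / b by rewrite !divr_gt0.
have [S' AS' SS'] := cS _ eb.
exists (S' \o T'); first exact: algebraic_comp.
have -> : (S \o T) - (S' \o T') = (S \o (T - T')) + ((S - S') \o T').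
  apply/funext => xi; have [lS _] := bS.
  have h : S (T xi) - S' (T' xi) = S (T xi - T' xi) + (S (T' xi) - S' (T' xi)).
    have -> : S (T xi - T' xi) = S (T xi) - S (T' xi).
      by rewrite -scaleN1r addrC lS scaleN1r addrC.
    by rewrite addrA subrK.
  exact: h.
apply: opnorm_le_mono (opnorm_leD (opnorm_le_comp (ltW a0) Sa TT')
  (opnorm_le_comp (ltW eb) SS' Tb)).
have -> : a * (e / 4 / a) = e / 4 by rewrite mulrC divfK // gt_eqF.
have -> : e / 4 / b * b = e / 4 by rewrite divfK // gt_eqF.
by lra.
Qed.

End reduced_composition.

(** * From matrix coefficients to a cocycle *)

Section local_cocycle.
Context {R : realType} {G H : groupType} {X Y : topologicalType}.
Context (aG : dynSys G X) (aH : dynSys H Y).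
Hypotheses (lcX : locally_compact [set: X]) (hausX : hausdorff_space X).
Hypothesis freeH : topologically_free aH.
Local Notation HilbG := (l2 R (G * X)%type).
Local Notation HilbH := (l2 R (H * Y)%type).
Variables (Phi : (HilbG -> HilbG) -> (HilbH -> HilbH)) (psi : Y -> X) (phi : X -> Y).
Hypothesis homeo : inverse_homeos psi phi.
Hypothesis Phi_reduced : forall T,
  reduced_crossed_product R aG T -> reduced_crossed_product R aH (Phi T).
Hypothesis PhiM : forall S T, reduced_crossed_product R aG S ->
  reduced_crossed_product R aG T -> Phi (S \o T) = Phi S \o Phi T.
Hypothesis Phi_pi : forall (u : C0 R X) (v : C0 R Y), (forall y, v y = u (psi y)) ->
  Phi (regular_pi aG u) = regular_pi aH v.
Local Notation delta1 y := (delta (1%g : H, y) : HilbH).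

(* Compare the coefficients at (h, y) of the images under Phi of both sides of
   n (b o g) = b n, where n = u g. *)
Lemma coef_intertwines (u : C0 R X) (g : G) (h : H) (y : Y) :
  Phi (regular_pi aG u \o regular_lambda g) (delta1 y) (h, y) <> 0 ->
  psi (aH h y) = aG g (psi y).
Proof.
set n := _ \o _ => m0; apply: (@c0_separates R X lcX hausX) => b.
have [bg bgE] := c0_comp b (act_homeo aG g).
have [c cE] := c0_comp b homeo; have [d dE] := c0_comp bg homeo.
have rn : reduced_crossed_product R aG n by exact: generator_reduced.
have nb : n \o regular_pi aG bg = regular_pi aG b \o n.
  apply/funext => xi; apply: l2_ext => p /=.
  by rewrite bgE -actM mulVKg mulrCA.
have := congr1 Phi nb; rewrite (PhiM rn (pi_reduced aG bg)) (PhiM (pi_reduced aG b) rn).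
rewrite (Phi_pi cE) (Phi_pi dE) => /(congr1 (fun T : HilbH -> HilbH => T (delta1 y) (h, y))).
have bn : bounded_op (Phi n) by case: (Phi_reduced rn).
rewrite /= pi_delta (linear_opZ _ _ bn) [LHS]/(d y * Phi n (delta1 y) (h, y)).
by rewrite dE bgE cE => /mulIf -> //; exact/eqP.
Qed.

(* Otherwise Phi(u g) kills the basis vector at (1, y), and so does
   Phi(u' g^-1) Phi(u g), which is the function (u' (u o g)) o psi in C_0(Y);
   take u(g psi(y)) = u'(psi(y)) = 1. *)
Lemma coef_neq0 (g : G) (y : Y) : exists (u : C0 R X) (h : H),
  Phi (regular_pi aG u \o regular_lambda g) (delta1 y) (h, y) <> 0.
Proof.
have [u [uy _]] := @c0_urysohn R X lcX hausX (aG g (psi y)) setT filterT.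
have [u' [u'y _]] := @c0_urysohn R X lcX hausX (psi y) setT filterT.
exists u; apply: contrapT => nh; set n := _ \o _ in nh.
have rn : reduced_crossed_product R aG n by exact: generator_reduced.
pose n' := regular_pi aG u' \o @regular_lambda R G X g^-1%g.
have rn' : reduced_crossed_product R aG n' by exact: generator_reduced.
have [ug ugE] := c0_comp u (act_homeo aG g).
have [w wE] := c0_mul u' ug; have [v vE] := c0_comp w homeo.
have n'n : n' \o n = regular_pi aG w.
  apply/funext => xi; apply: l2_ext => -[k x] /=.
  by rewrite invgK mulKg wE ugE actM mulrA.
have m0 : Phi n (delta1 y) = 0.
  apply: l2_ext => -[h y']; have [->|yy'] := pselect (y' = y).
    by apply: contrapT => m0; apply: nh; exists h.
  by apply: (reduced_coef_off _ (Phi_reduced rn) yy').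
have := Phi_pi vE; rewrite -n'n (PhiM rn' rn).
move=> /(congr1 (fun T : HilbH -> HilbH => T (delta1 y) (1%g, y))).
rewrite /= m0 linear_op0; last by case: (Phi_reduced rn').
rewrite eqxx act1 mulr1 vE wE ugE uy u'y mulr1 => /eqP.
by rewrite eq_sym oner_eq0.
Qed.

Lemma local_cocycle (g : G) (y : Y) : exists h : H,
  \forall z \near y, psi (aH h z) = aG g (psi z).
Proof.
have [u [h m0]] := coef_neq0 g y; exists h.
have rn := generator_reduced aG u g.
(* The tolerance is [|m|] itself: a coefficient vanishing at [z] would be at distance exactly [|m|]
   from [m]. *)
have /continuous_normc/(_ y) := reduced_coef_continuous (g := h) (Phi_reduced rn).
move: m0; set m := Phi _ => /eqP; rewrite -normc_gt0 => m0 /(_ _ m0).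
apply: filterS => z hz; apply: (coef_intertwines (u := u)) => mz0.
by move: hz; rewrite [X in _ - X]mz0 subr0 ltxx.
Qed.

Lemma cocycle_of_isomorphism : exists a : discrete_topology G * X -> discrete_topology H,
  continuous a /\ forall g x, phi (aG g x) = aH (a (g, x)) (phi x).
Proof.
have [psiK phiK cpsi cphi] := homeo.
have [k kP] := choice (fun p : G * Y => local_cocycle p.1 p.2).
exists (fun p => k (p.1 : G, phi p.2)); split; last first.
  by move=> g x; have /nbhs_singleton/= := kP (g, phi x); rewrite phiK => <-; rewrite psiK.
apply: tg_continuous => g x; apply/discrete_cvg.
apply: (cphi x [set z | k (g, z) = k (g, phi x)]).
(* [k] is a bare choice. For [z] near [phi x], both [k (g, z)] and [k (g, phi x)] satisfy the local
   relation on a neighbourhood of [z], and freeness makes them equal. *)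
have := near_join (kP (g, phi x)).
rewrite /nbhs /=; apply: filterS => z hz; apply: (free_near_inj freeH (x := z)).
apply: filterS2 (kP (g, z)) hz => z' /= h1 h2.
by apply: (can_inj psiK); rewrite h1 h2.
Qed.

End local_cocycle.

Section cstar_orbit_equivalence.
Context {R : realType} {G H : groupType} {X Y : topologicalType}.
Context (aG : dynSys G X) (aH : dynSys H Y).
Hypotheses (lcX : locally_compact [set: X]) (hausX : hausdorff_space X).
Hypotheses (lcY : locally_compact [set: Y]) (hausY : hausdorff_space Y).
Hypotheses (freeG : topologically_free aG) (freeH : topologically_free aH).

Lemma cstar_coe (Phi : _ -> _) :
  cstar_isomorphism (reduced_crossed_product R aG)
                    (reduced_crossed_product R aH) Phi ->
  Phi @` C0_in_crossed_product R aG = C0_in_crossed_product R aH ->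
  continuously_orbit_equivalent aG aH.
Proof.
move=> [[PhiR PhiI PhiS] PhiD PhiZ PhiM _] PhiC.
have pG (u : C0 R X) := pi_reduced aG u.
have Phi_inj S T : reduced_crossed_product R aG S -> reduced_crossed_product R aG T ->
    Phi S = Phi T -> S = T.
  by move=> rS rT; exact: PhiI (mem_set rS) (mem_set rT).
have pi_inj (u v : C0 R Y) : regular_pi aH u = regular_pi aH v -> u = v.
  by move=> uv; apply: c0_ext => y; rewrite -(pi_coef aH) uv pi_coef.
have thetaP (u : C0 R X) : exists v, Phi (regular_pi aG u) = regular_pi aH v.
  have : (Phi @` C0_in_crossed_product R aG) (Phi (regular_pi aG u)).
    by exists (regular_pi aG u) => //; exists u.
  by rewrite PhiC => -[v _ <-]; exists v.
have theta'P (v : C0 R Y) : exists u, Phi (regular_pi aG u) = regular_pi aH v.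
  have : C0_in_crossed_product R aH (regular_pi aH v) by exists v.
  by rewrite -PhiC => -[_ [u _ <-] uv]; exists u.
(* [theta] is [Phi] read on functions, with inverse [theta']. *)
have [theta thetaE] := choice thetaP; have [theta' theta'E] := choice theta'P.
have theta'K v : theta (theta' v) = v by apply: pi_inj; rewrite -thetaE theta'E.
have theta_inj : injective theta.
  move=> u v uv; apply: c0_ext => x; rewrite -(pi_coef aG) -[RHS](pi_coef aG).
  by rewrite (Phi_inj _ _ (pG u) (pG v)) // !thetaE uv.
have thetaK u : theta' (theta u) = u by apply: theta_inj; rewrite theta'K.
have morph : c0_morphism theta.
  split=> [f g h hE y|f g h hE y|c f h hE y].
  - have e : regular_pi aG h = regular_pi aG f + regular_pi aG g.
      apply/funext => xi; apply: l2_ext => p.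
      have e : h (aG p.1 p.2) * xi p = f (aG p.1 p.2) * xi p + g (aG p.1 p.2) * xi p.
        by rewrite hE mulrDl.
      exact: e.
    rewrite -!(pi_coef aH) -!thetaE e (PhiD _ _ (pG f) (pG g)).
    by [].
  - have e : regular_pi aG h = regular_pi aG f \o regular_pi aG g.
      by apply/funext => xi; apply: l2_ext => p /=; rewrite hE mulrA.
    rewrite -(pi_coef aH) -thetaE e (PhiM _ _ (pG f) (pG g)) !thetaE /=.
    by rewrite eqxx act1 mulr1.
  - have e : regular_pi aG h = c *: regular_pi aG f.
      apply/funext => xi; apply: l2_ext => p.
      have e : h (aG p.1 p.2) * xi p = c * (f (aG p.1 p.2) * xi p) by rewrite hE mulrA.
      exact: e.
    rewrite -!(pi_coef aH) -!thetaE e (PhiZ _ _ (pG f)).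
    by [].
have morph' : c0_morphism theta'.
  case: morph => tD tM tZ; split=> [f g h hE|f g h hE|c f h hE].
  - have [s sE] := c0_add (theta' f) (theta' g); move=> x; rewrite -sE; congr (c0fun _ x).
    by apply: theta_inj; apply: c0_ext => y; rewrite (tD _ _ _ sE) !theta'K.
  - have [s sE] := c0_mul (theta' f) (theta' g); move=> x; rewrite -sE; congr (c0fun _ x).
    by apply: theta_inj; apply: c0_ext => y; rewrite (tM _ _ _ sE) !theta'K.
  - have [s sE] := c0_scale c (theta' f); move=> x; rewrite -sE; congr (c0fun _ x).
    by apply: theta_inj; apply: c0_ext => y; rewrite (tZ _ _ _ sE) !theta'K.
have [psi cpsi psiE] := gelfand lcX hausX lcY hausY morph
  (fun v => ex_intro _ (theta' v) (theta'K v)).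
have [phi cphi phiE] := gelfand lcY hausY lcX hausX morph'
  (fun u => ex_intro _ (theta u) (thetaK u)).
have phiK : cancel phi psi.
  by move=> x; apply: (c0_separates (R := R) lcX hausX) => u; rewrite -psiE -phiE thetaK.
have psiK : cancel psi phi.
  by move=> y; apply: (c0_separates (R := R) lcY hausY) => v; rewrite -phiE -psiE theta'K.
have Phi_pi (u : C0 R X) (v : C0 R Y) : (forall y, v y = u (psi y)) -> Phi (regular_pi aG u) = regular_pi aH v.
  move=> vu; rewrite thetaE; congr regular_pi; apply: c0_ext => y.
  by rewrite vu psiE.
(* [Phi'] inverts [Phi] on the crossed product, with the arbitrary value [0] elsewhere; it yields
   the cocycle [b] as [Phi] yields [a]. *)
have PhiV T : exists S, reduced_crossed_product R aH T ->
    reduced_crossed_product R aG S /\ Phi S = T.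
  have [rT|nT] := pselect (reduced_crossed_product R aH T); last by exists 0.
  by have [S rS ST] := PhiS _ rT; exists S.
have [Phi' Phi'P] := choice PhiV.
have [a [ca aE]] := cocycle_of_isomorphism lcX hausX freeH
  (And4 psiK phiK cpsi cphi) PhiR PhiM Phi_pi.
have [||||b [cb bE]] := @cocycle_of_isomorphism R H G Y X aH aG lcY hausY freeG Phi' phi psi.
- by split.
- by move=> T /Phi'P[].
- move=> S T rS rT; have [rS' PS] := Phi'P _ rS; have [rT' PT] := Phi'P _ rT.
  have [rST PST] := Phi'P _ (reduced_comp rS rT).
  apply: (Phi_inj _ _ rST (reduced_comp rS' rT')).
  by rewrite PST (PhiM _ _ rS' rT') PS PT.
- move=> v u uv; have [rv Pv] := Phi'P _ (pi_reduced aH v).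
  apply: (Phi_inj _ _ rv (pG u)); rewrite Pv; apply/esym/Phi_pi => y.
  by rewrite uv psiK.
by exists phi, psi, a, b; split.
Qed.

End cstar_orbit_equivalence.

Theorem theorem1p2 (R : realType) (G H : groupType) (X Y : topologicalType)
    (aG : dynSys G X) (aH : dynSys H Y)
    (countG : countable [set: G]) (countH : countable [set: H])
    (lcX : locally_compact [set: X]) (lcY : locally_compact [set: Y])
    (hausX : hausdorff_space X) (hausY : hausdorff_space Y)
    (scX : @second_countable X) (scY : @second_countable Y)
    (freeG : topologically_free aG) (freeH : topologically_free aH) :
  (continuously_orbit_equivalent aG aH <->
     topGroupoid_isomorphic (transformation_groupoid aG)
                            (transformation_groupoid aH)) /\
  (topGroupoid_isomorphic (transformation_groupoid aG)
                          (transformation_groupoid aH) <->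
     exists Phi,
       cstar_isomorphism (reduced_crossed_product R aG)
                         (reduced_crossed_product R aH) Phi /\
       Phi @` C0_in_crossed_product R aG = C0_in_crossed_product R aH).
Proof.
have coe_gpd := @coe_groupoid _ _ _ _ aG aH freeG freeH.
have gpd_coe := @groupoid_coe _ _ _ _ aG aH.
split; split => //; first exact: groupoid_cstar.
move=> [Phi [iso PhiC]]; apply: coe_gpd.
exact: (cstar_coe lcX hausX lcY hausY freeG freeH iso PhiC).
Qed.
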